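(* Let $L$ be a finite-dimensional (left) Leibniz algebra over a field of characteristic $0$, and let $N=\mathrm{Nil}(L)$. Then $L$ has a unique maximal ideal if and only if one of the following holds: (1) $L$ is nilpotent and cyclic; or (2) $L=N+S$, where $S$ is a simple subalgebra of $L$, and $N/N^2=S(N/N^2)+(N/N^2)S$; or (3) $L=N+\langle x\rangle$, where $\langle x\rangle$ is a one-dimensional vector space, $x^2\neq 0$, and $N/N^2=x(L/N^2)$; or (4) $L=N+\langle x\rangle$, where $\langle x\rangle$ is a one-dimensional vector space, $x^2=0$, and $N/N^2=x(N/N^2)+(N/N^2)x$.
   Context: A (left) Leibniz algebra is a vector space $L$ with a bilinear product satisfying $x(yz)=(xy)z+y(xz)$ for all $x,y,z\in L$; the product need not be antisymmetric. Ideals are two-sided; a maximal ideal is a maximal proper ideal. A Leibniz algebra $A$ is nilpotent if its lower central series $A^1=A$, $A^{k+1}=AA^k$ reaches $0$. $\mathrm{Nil}(L)$, the nilradical, is the largest nilpotent ideal of $L$. $L$ is cyclic if it is generated as an algebra by a single element. A subalgebra $S$ is simple if $S^2\neq 0$ and its only ideals are $0$ and $S$. For subspaces $U,V$, $UV$ is the span of all products $uv$ with $u\in U$, $v\in V$; $N^2=NN$ is an ideal of $L$. $\langle x\rangle$ is the linear span of $x$. Products such as $S(N/N^2)$, $x(L/N^2)$, $(N/N^2)x$ are taken in $L/N^2$ using the images of $S$ and $x$ there.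
   Formalization: L is assumed nonzero: the zero algebra is nilpotent and cyclic, so it satisfies (1), but it has no proper ideal and hence no maximal ideal. *)

(* Defs.v *)
From HB Require Import structures.
From mathcomp Require Import all_boot all_order all_algebra.

Set Implicit Arguments.
Unset Strict Implicit.
Unset Printing Implicit Defensive.

Import GRing.Theory.
Local Open Scope ring_scope.

Section Products.
Variables (F : fieldType) (L : vectType F) (mu : {bilinear L -> L -> L}).
Implicit Types U V W A I : {vspace L}.

Definition leibniz :=
  forall x y z : L, mu x (mu y z) = mu (mu x y) z + mu y (mu x z).

(* The span of all products; independence of the chosen bases is prodvsP. *)
Definition prodvs U V : {vspace L} :=
  <<[seq mu u v | u <- vbasis U, v <- vbasis V]>>%VS.

Lemma prodvsP U V W :
  reflect (forall u v, u \in U -> v \in V -> mu u v \in W)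
          (prodvs U V <= W)%VS.
Proof.
apply: (iffP span_subvP) => [UVW u v Uu Vv | UVW _ /allpairsP[[u v] /=
    [/vbasis_mem Uu /vbasis_mem Vv ->]]]; last exact: UVW.
rewrite (coord_vbasis Uu) (coord_vbasis Vv) linear_sumlz /= rpred_sum // => i _.
rewrite linear_sumr /= rpred_sum // => j _.
rewrite linearZl_LR linearZr_LR /= !rpredZ //.
by apply/UVW/allpairs_f; apply: mem_nth; rewrite size_tuple.
Qed.

Lemma memv_prodvs U V u v : u \in U -> v \in V -> mu u v \in prodvs U V.
Proof. by move: u v; apply/prodvsP. Qed.

Definition subalgebra A := (prodvs A A <= A)%VS.

Definition ideal_of A I :=
  [&& (I <= A)%VS, (prodvs A I <= I)%VS & (prodvs I A <= I)%VS].

Definition ideal I := ideal_of {:L} I.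

Definition maximal_ideal I :=
  [/\ ideal I, I != fullv &
      forall J, ideal J -> (I <= J)%VS -> J = I \/ J = fullv].

(* Indexed from 0: lcs A k is the term A^(k+1) of the lower central series. *)
Definition lcs A (k : nat) : {vspace L} := iter k (prodvs A) A.

Definition nilpotent A := exists k, lcs A k = 0%VS.

Definition nilradical N :=
  [/\ ideal N, nilpotent N &
      forall I, ideal I -> nilpotent I -> (I <= N)%VS].

Definition cyclic :=
  exists x, forall A, subalgebra A -> x \in A -> A = fullv.

Definition simple_subalgebra S :=
  [/\ subalgebra S, prodvs S S != 0%VS &
      forall I, ideal_of S I -> I = 0%VS \/ I = S].

End Products.

Section Quotient.
Variables (F : fieldType) (L : vectType F).

(* The quotient space L / I is realised on the complement I^C, each coset of I
   being represented by its unique element in I^C. Note that vsproj I^C alone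
   would project along (I^C)^C, which need not be I. *)
Definition quotvs (I : {vspace L}) : vectType F := subvs_of (I^C)%VS.

Definition quot_proj (I : {vspace L}) : 'Hom(L, quotvs I) :=
  linfun (vsproj (I^C)%VS \o daddv_pi (I^C)%VS I).

Definition quot_repr (I : {vspace L}) (a : quotvs I) : L := vsval a.

Variables (mu : {bilinear L -> L -> L}) (I : {vspace L}).

Definition quot_mul (a b : quotvs I) : quotvs I :=
  quot_proj I (mu (quot_repr a) (quot_repr b)).

Lemma quot_mul_bilinear : bilinear_for *:%R *:%R quot_mul.
Proof.
split=> [b | a] k x y; rewrite /quot_mul /quot_repr.
  by rewrite (linearP (@vsval _ _ _)) linearPl linearP.
by rewrite (linearP (@vsval _ _ _)) linearPr linearP.
Qed.

HB.instance Definition _ := bilinear_isBilinear.Build F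
  (quotvs I) (quotvs I) (quotvs I) *:%R *:%R quot_mul quot_mul_bilinear.

Lemma quot_projE x : vsval (quot_proj I x) = daddv_pi (I^C)%VS I x.
Proof. by rewrite lfunE /= vsprojK ?memv_pi. Qed.

Lemma quot_reprK : cancel (@quot_repr I) (quot_proj I).
Proof.
move=> a; apply: val_inj; rewrite [LHS]quot_projE.
by rewrite daddv_pi_id ?subvsP // capvC capv_compl.
Qed.

Lemma quot_proj_surj : limg (quot_proj I) = fullv.
Proof.
apply/vspaceP=> a; rewrite memvf; apply/memv_imgP.
by exists (quot_repr a); rewrite ?memvf ?quot_reprK.
Qed.

Lemma quot_proj_ker : lker (quot_proj I) = I.
Proof.
have dIC : (I^C :&: I = 0)%VS by rewrite capvC capv_compl.
apply/vspaceP=> x; rewrite memv_ker -(inj_eq val_inj) [val _]quot_projE.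
have Lx : x \in (I^C + I)%VS by rewrite addvC addv_complf memvf.
have pxE := daddv_pi_add dIC Lx; apply/eqP/idP => [p0 | Ix].
  by rewrite -pxE p0 add0r memv_pi.
apply: (addIr x); rewrite /= add0r -[RHS]pxE; congr (_ + _).
by rewrite daddv_pi_id // capvC.
Qed.

Lemma quot_projM x y : ideal mu I ->
  quot_proj I (mu x y) = quot_mul (quot_proj I x) (quot_proj I y).
Proof.
case/and3P=> _ /prodvsP LI /prodvsP IL.
have memI z : (z \in I) = (quot_proj I z == 0).
  by rewrite -memv_ker quot_proj_ker.
have dev z : quot_repr (quot_proj I z) - z \in I.
  by rewrite memI linearB /= quot_reprK subrr.
apply/eqP; rewrite /quot_mul -subr_eq0 -linearB /= -memI.
set x' := quot_repr _; set y' := quot_repr _.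
have ->: mu x y - mu x' y' = - (mu (x' - x) y' + mu x (y' - y)).
  by rewrite linearBl linearBr subrKA opprB.
rewrite rpredN rpredD //; [apply: IL | apply: LI]; rewrite ?memvf //; exact: dev.
Qed.

End Quotient.

Arguments quot_mul {F L} mu I a b.

(* Main.v *)
(* Let M be the unique maximal ideal.  M lies in L^2, since any hyperplane
   containing L^2 is an ideal.  The crux is that M is nilpotent.  By induction on
   dim L, some term of the lower central series of M lies in a minimal ideal J
   contained in M.  If J^2 = 0, then M acts trivially on the irreducible left
   module J, because an element acting as a sum of brackets [x, y] with all the y
   commuting with it has only zero power traces.  If J^2 = J, the Killing form of
   J is nondegenerate by Cartan's criterion, so J has a complementary ideal, which
   contradicts the uniqueness of M.
   Hence N = L or N = M.  If L^2 = L, then L/M is simple and M has a complement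
   S: the Casimir operator gives the first Whitehead lemma for L/M, and applying
   it to projections of L onto an abelian quotient of M (as in Bourbaki's proof
   of the Levi-Malcev theorem) yields a proper subalgebra supplementing M.  If
   L^2 <> L, then L^2 = M is a hyperplane and L is either nilpotent or N + <x>. *)

Require Import Defs.
From HB Require Import structures.
From mathcomp Require Import all_boot all_order all_algebra all_field.
From mathcomp Require Import ring.
From Stdlib Require Import Classical_Prop.

Set Implicit Arguments.
Unset Strict Implicit.
Unset Printing Implicit Defensive.

Import GRing.Theory Num.Theory passmx.
Local Open Scope ring_scope.

(** * Cartan's criterion *)

(** The obstacle is that the product is not antisymmetric: only left multiplications form a
    representation, so the Lie-theoretic tools see the left structure alone. A minimal ideal J
    repairs this: either jx = -xj for all j in J and all x, or jx = 0 for all of them, and in both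
    cases the left submodules of J are ideals, so J is irreducible as a left module. The left action
    is also all that nilpotency needs, since the lower central series multiplies by M on the left
    only: once a term of it lies in J, MJ = 0 ends it. The ground field is arbitrary, so eigenvalues
    are taken in a splitting extension and tested by Q-linear functionals, which play the part of
    complex conjugation. For the converse, each of (2), (3), (4) gives N <= L^2, because N/N^2 is
    spanned by products and N^2 <= L^2. A maximal ideal M' not containing N would satisfy M' + N =
    L, so that L/M' would be both nilpotent, as an image of N, and perfect, as N <= L^2; hence zero.
    In (1) the same argument runs with L^2 in place of N. *)

Lemma splitting_extension n (F : fieldType) (p : {poly F}) :
  (size p <= n)%N -> p \is monic ->
  exists (K : fieldType) (f : {rmorphism F -> K}) (s : seq K),
    map_poly f p = \prod_(x <- s) ('X - x%:P).
Proof.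
elim: n F p => [|n IHn] F p szp pm.
  by move: szp; rewrite leqn0 size_poly_eq0 => /eqP p0; move: pm;
      rewrite p0 monicE lead_coef0 eq_sym oner_eq0.
have [sz1|sz1] := leqP (size p) 1.
  exists F, idfun, [::]; rewrite big_nil map_poly_id //.
  by move: sz1 pm => /size1_polyC ->; rewrite monicE lead_coefC => /eqP ->.
have [q irrq qp]: exists2 q, irreducible_poly q & q %| p.
  have [k] := ubnP (size p); elim: k p sz1 {szp pm} => // k IHk p sz1 lek.
  have [irr|nirr] := classic (irreducible_poly p); first by exists p.
  have [q [q1 qp qNp]]: exists q : {poly F}, [/\ size q != 1%N, q %| p & ~~ (q %= p)].
    apply: NNPP => H; apply: nirr; split=> // q q1 qp; apply: contraT => nq.
    by case: H; exists q.
  have p0: p != 0 by rewrite -size_poly_gt0; apply: ltn_trans sz1.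
  have q0: q != 0 by apply: contraNneq p0 => q0; move: qp; rewrite q0 dvd0p.
  have ltq: (size q < size p)%N.
    rewrite ltn_neqAle dvdp_leq // andbT; apply: contra qNp => /eqP e.
    by rewrite -dvdp_size_eqp // e.
  have [||r ir rq] := IHk q; last by exists r => //; apply: dvdp_trans qp.
    by rewrite ltn_neqAle eq_sym q1 size_poly_gt0.
  by apply: leq_trans ltq _; rewrite -ltnS.
(* Adjoin a root [z] of [q], divide [p] by X - z, and recurse over the larger field; the embeddings
   compose. *)
have [L _ [z rz _]] := irredp_FAdjoin irrq.
have rp: root (map_poly (in_alg L) p) z.
  by apply: root_dvdp rz; rewrite dvdp_map.
have /factor_theorem[r pr] := rp.
have pm': map_poly (in_alg L) p \is monic by rewrite map_monic.
have rm: r \is monic by move: pm'; rewrite pr monicMr ?monicXsubC.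
have szr: (size r <= n)%N.
  have r0 := monic_neq0 rm.
  move: szp; rewrite -(size_map_poly (in_alg L)) pr size_Mmonic ?monicXsubC //.
  by rewrite size_XsubC addn2.
have [K [f [s rs]]] := IHn _ r szr rm.
exists K, (f \o in_alg L)%FUN, (rcons s (f z)).
by rewrite map_poly_comp pr rmorphM /= rs big_rcons /= rmorphB /= map_polyX map_polyC.
Qed.

Section CRT.
Variable K : fieldType.

(** With [u * M + w * ('X - x%:P) ^+ N = 1], adding [u * M * ((v x)%:P - p)] corrects [p] at the new
    node and keeps the congruences at the old ones. This yields both the spectral idempotents and
    the interpolation behind Cartan's criterion. *)
Lemma poly_crt N (v : K -> K) (t : seq K) : uniq t ->
  exists p : {poly K}, forall x, x \in t -> ('X - x%:P) ^+ N %| p - (v x)%:P.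
Proof.
elim: t => [|x t IHt] /=; first by exists 0.
case/andP=> xt /IHt[p pP].
pose M : {poly K} := \prod_(y <- t) ('X - y%:P) ^+ N.
have cop: coprimep M (('X - x%:P) ^+ N).
  apply: coprimep_expr; rewrite coprimep_sym.
  rewrite /M big_seq; apply: (big_ind (coprimep _)) => [|p1 p2|y yt].
  - exact: coprimep1.
  - by move=> c1 c2; rewrite coprimepMr c1.
  - by apply: coprimep_expr; apply: coprimep_XsubC2; rewrite subr_eq0; apply: contraNneq xt => <-.
have /Bezout_eq1_coprimepP[[u w] /= uv1] := cop.
exists (p + u * M * ((v x)%:P - p)) => y; rewrite inE => /predU1P[->|yt].
  have -> : p + u * M * ((v x)%:P - p) - (v x)%:P = (p - (v x)%:P) * (1 - u * M).
    by ring.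
  by rewrite -uv1 addrAC subrr add0r mulrA dvdp_mulIr.
rewrite addrAC dvdp_add ?pP // dvdp_mulr // dvdp_mull // /M (big_rem y) //=.
exact: dvdp_mulIl.
Qed.

Lemma dvdp_prod_uniq N (t : seq K) (p : {poly K}) : uniq t ->
  (forall x, x \in t -> ('X - x%:P) ^+ N %| p) -> \prod_(x <- t) ('X - x%:P) ^+ N %| p.
Proof.
elim: t => [|x t IHt] /=; first by rewrite big_nil dvd1p.
case/andP=> xt ut pP; rewrite big_cons Gauss_dvdp; last first.
  rewrite big_seq; apply: (big_ind (coprimep _)) => [|p1 p2|y yt].
  - exact: coprimep1.
  - by move=> c1 c2; rewrite coprimepMr c1.
  - by apply/coprimep_expl/coprimep_expr/coprimep_XsubC2; rewrite subr_eq0;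
      apply: contraNneq xt => <-.
rewrite pP ?mem_head //=; apply: IHt => // y yt; apply: pP.
by rewrite inE yt orbT.
Qed.

End CRT.

Lemma rank_factorization (K : fieldType) n (A : 'M[K]_n) :
  exists (C : 'M_(n, \rank A)) (R : 'M_(\rank A, n)), [/\ A = C *m R, row_full C & row_free R].
Proof.
by exists (col_base A), (row_base A); rewrite mulmx_base col_base_full row_base_free.
Qed.

(** For a rank factorization [A = C *m R], the matrix [R *m C] has the same trace and a nilpotency
    exponent smaller by one. The induction ends at exponent 0, where the identity itself is zero. *)
Lemma mxtrace_nilp (K : fieldType) m n (A : 'M[K]_n) : iter m (mulmx A) 1%:M = 0 -> \tr A = 0.
Proof.
elim: m n A => [|m IHm] n A.
  by move=> /= e; rewrite -[A]mul1mx e mul0mx mxtrace0.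
have [C [R []]] := rank_factorization A; move: (\rank A) C R => r C R -> fullC freeR.
have iterE k : C *m iter k (mulmx (R *m C)) 1%:M *m R = iter k.+1 (mulmx (C *m R)) 1%:M.
  elim: k => [|k IHk]; first by rewrite /= !mulmx1.
  by rewrite [RHS]iterS -IHk [in LHS]/= !mulmxA.
rewrite -iterE => /eqP e; rewrite mxtrace_mulC; apply: IHm.
apply: (row_full_inj fullC); rewrite mulmx0; apply/eqP.
by rewrite -(mulmx_free_eq0 _ freeR) e.
Qed.

(** Cancelling [C] on the left and [R] on the right of CRCR = CR leaves RC = 1, of size the rank. *)
Lemma mxtrace_idem (K : fieldType) n (E : 'M[K]_n) : E *m E = E -> \tr E = (\rank E)%:R.
Proof.
have [C [R []]] := rank_factorization E; move: (\rank E) C R => r C R -> fullC freeR.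
move=> /eqP; rewrite -subr_eq0 !mulmxA -mulmxBl mulmx_free_eq0 //.
rewrite subr_eq0 -mulmxA -[X in _ == X]mulmx1 => /eqP/(row_full_inj fullC) RC.
by rewrite mxtrace_mulC RC mxtrace1.
Qed.

(** * Rational scalars in characteristic 0 *)

Section RatEmb.
Variable (K : fieldType) (char0 : [pchar K] =i pred0).

Lemma pchar0_intr_eq0 (z : int) : (z%:~R == 0 :> K) = (z == 0).
Proof.
have natr_eq0 n : (n%:R == 0 :> K) = (n == 0%N) by move: n; apply/pcharf0P.
by case: z => n; rewrite ?NegzE ?mulrNz ?oppr_eq0 natr_eq0.
Qed.

Definition ratK (q : rat) : K := (numq q)%:~R / (denq q)%:~R.

Lemma denqK_neq0 q : (denq q)%:~R != 0 :> K.
Proof. by rewrite pchar0_intr_eq0 denq_neq0. Qed.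

Lemma ratK_frac (a b : int) : b != 0 -> ratK (a%:Q / b%:Q) = a%:~R / b%:~R.
Proof.
move=> b0; set q := _ / _.
apply/eqP; rewrite eqr_div ?denqK_neq0 ?pchar0_intr_eq0 // -!intrM.
suff -> : numq q * b = a * denq q by [].
apply: (@intr_inj rat); rewrite !intrM.
have d0 : (denq q)%:~R != 0 :> rat by rewrite intr_eq0 denq_neq0.
have b0' : b%:~R != 0 :> rat by rewrite intr_eq0.
by apply/eqP; rewrite -eqr_div // divq_num_den.
Qed.

Lemma ratK_add x y : ratK (x + y) = ratK x + ratK y.
Proof.
have dx := denq_neq0 x; have dy := denq_neq0 y.
have -> : x + y = (numq x * denq y + numq y * denq x)%:Q / (denq x * denq y)%:Q.
  rewrite !(intrD, intrM) -{1}(divq_num_den x) -{1}(divq_num_den y) addf_div //.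
    by rewrite intr_eq0.
  by rewrite intr_eq0.
by rewrite ratK_frac ?mulf_neq0 // !(intrD, intrM) -addf_div ?denqK_neq0.
Qed.

Lemma ratK_mul x y : ratK (x * y) = ratK x * ratK y.
Proof.
have dx := denq_neq0 x; have dy := denq_neq0 y.
have -> : x * y = (numq x * numq y)%:Q / (denq x * denq y)%:Q.
  by rewrite !intrM -{1}(divq_num_den x) -{1}(divq_num_den y) mulf_div.
by rewrite ratK_frac ?mulf_neq0 // !intrM -mulf_div.
Qed.

Lemma ratK_int (z : int) : ratK z%:Q = z%:~R.
Proof. by rewrite -[z%:Q]divr1 (@ratK_frac z 1) // divr1. Qed.

Lemma ratK0 : ratK 0 = 0. Proof. exact: (ratK_int 0). Qed.
Lemma ratK1 : ratK 1 = 1. Proof. exact: (ratK_int 1). Qed.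

Lemma ratK_opp x : ratK (- x) = - ratK x.
Proof. by apply/eqP; rewrite -addr_eq0 -ratK_add addNr ratK0. Qed.

Lemma ratK_sub x y : ratK (x - y) = ratK x - ratK y.
Proof. by rewrite ratK_add ratK_opp. Qed.

Lemma ratK_sum I (r : seq I) (P : pred I) G : ratK (\sum_(i <- r | P i) G i)
    = \sum_(i <- r | P i) ratK (G i).
Proof. exact: (big_morph ratK ratK_add ratK0). Qed.

(* The functionals [f] range over the orthogonal of the space of rational
   relations between the [x i]; if every [w f] is itself such a relation, then
   [sum w f^2 = 0]. *)
Lemma rational_functionals m (x : 'I_m -> K) (w : 'I_m -> nat) :
  (forall f : 'I_m -> rat,
     (forall r : 'I_m -> rat, \sum_i ratK (r i) * x i = 0 -> \sum_i r i * f i = 0) ->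
     \sum_i ratK (f i) * x i * (w i)%:R = 0) ->
  forall i, w i = 0%N \/ x i = 0.
Proof.
move=> H.
pose rel (A : 'M[rat]_m) := forall k, \sum_i ratK (A k i) * x i = 0.
have rel_sub (A : 'M[rat]_m) (r : 'rV_m) : rel A -> (r <= A)%MS -> \sum_i ratK (r 0 i) * x i = 0.
  move=> relA /submxP[D ->].
  under eq_bigr => i _ do rewrite mxE ratK_sum mulr_suml.
  rewrite exchange_big big1 // => k _.
  under eq_bigr => i _ do rewrite ratK_mul -mulrA.
  by rewrite -mulr_sumr relA mulr0.
(* The row space of [A] is the whole space of rational relations: a matrix of relations is enlarged
   until it absorbs every one of them. *)
have [A relA Amax] : exists2 A, rel A & forall r : 'rV_m, \sum_i ratK (r 0 i) * x i = 0 ->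
    (r <= A)%MS.
  have: rel 0 by move=> k; rewrite big1 // => i _; rewrite mxE ratK0 mul0r.
  have [k] := ubnP (m - \rank (0 : 'M[rat]_m)); elim: k (0 : 'M_m) => // k IHk A lek relA.
  have [nmax|max] := classic (exists2 r : 'rV_m, \sum_i ratK (r 0 i)
      * x i = 0 & ~~ (r <= A)%MS); last first.
    by exists A => // r r0; apply: contraT => nr; case: max; exists r.
  have [r r0 nr] := nmax.
  apply: (IHk (A + r)%MS).
    have ltr : (\rank A < \rank (A + r)%MS)%N.
      rewrite ltn_neqAle mxrankS ?addsmxSl // andbT; apply: contra nr => /eqP e.
      have: (A + r <= A)%MS.
        by rewrite -(geq_leqif (mxrank_leqif_sup (addsmxSl A r))) e.
      by apply: submx_trans; apply: addsmxSr.
    apply: leq_trans (_ : m - \rank A <= k)%N; last by [].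
    by apply: ltn_sub2l => //; apply: leq_trans ltr (rank_leq_row _).
  move=> i; have /sub_addsmxP[[u v] /= e] : (row i (A + r)%MS <= A + r)%MS by exact: row_sub.
  transitivity (\sum_j ratK ((u *m A) 0 j) * x j + \sum_j ratK ((v *m r) 0 j) * x j).
    rewrite -big_split /=; apply: eq_bigr => j _; rewrite -mulrDl -ratK_add; congr (ratK _ * _).
    by move/rowP/(_ j): e; rewrite !mxE.
  rewrite (rel_sub A) ?submxMl // add0r.
  under eq_bigr => j _ do rewrite mxE big_ord1 ratK_mul -mulrA.
  by rewrite -mulr_sumr r0 mulr0.
move=> i.
have relP (r : 'rV_m) : (r <= A)%MS <-> r *m cokermx A = 0.
  by rewrite submxE; split => [/eqP|->].
case: (posnP (w i)) => [|wi]; [by left | right].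
(* Each column of [cokermx A] is a functional [f] vanishing on all relations. As [w i] is positive,
   sum w f^2 = 0 forces [f i = 0]. So the unit vector at [i] is itself a relation, which says
   [x i = 0]. *)
have dA : ((delta_mx 0 i : 'rV_m) <= A)%MS.
  apply/relP/rowP => j; rewrite -rowE [LHS]mxE [RHS]mxE.
  pose f k := cokermx A k j.
  have fP (r : 'I_m -> rat) : \sum_i ratK (r i) * x i = 0 -> \sum_i r i * f i = 0.
    move=> e; have /Amax/relP/rowP/(_ j) : \sum_i ratK ((\row_k r k) 0 i) * x i = 0.
      by under eq_bigr => k _ do rewrite mxE.
    by rewrite !mxE; under eq_bigr => k _ do rewrite mxE.
  have := H f fP; have := fP (fun k => f k * (w k)%:R).
  under eq_bigr => k _ do rewrite ratK_mul -[_%:R]/((w k)%:Z%:Q) ratK_int mulrAC.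
  move=> h1 /h1 /eqP; rewrite psumr_eq0 => [/allP/(_ i (mem_index_enum _))|k _].
    by rewrite mulrAC mulf_eq0 pnatr_eq0 -(negbK (w i == _)) -lt0n wi orbF mulf_eq0 orbb => /eqP.
  by rewrite mulrAC mulr_ge0 ?ler0n // -expr2 sqr_ge0.
have := rel_sub _ _ relA dA; rewrite (bigD1 i) //= big1 ?addr0 => [|k ki].
  by rewrite mxE !eqxx ratK1 mul1r.
by rewrite mxE (negbTE ki) andbF ratK0 mul0r.
Qed.

End RatEmb.

Section PolyAction.
Variables (K : fieldType) (V : lmodType K) (T : {linear V -> V}).

(** This is p(T) applied to [y]: the K[X]-module structure on [V] in which X acts as [T]. *)
Definition poly_act (p : {poly K}) (y : V) := \sum_(k < size p) p`_k *: iter k T y.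

Lemma poly_act_widen m (p : {poly K}) y : (size p <= m)%N ->
  poly_act p y = \sum_(k < m) p`_k *: iter k T y.
Proof.
move=> lem; rewrite /poly_act (big_ord_widen m (fun k => p`_k *: iter k T y)) //.
rewrite big_mkcond /=; apply: eq_bigr => k _; case: ltnP => // lek.
by rewrite nth_default // scale0r.
Qed.

Lemma poly_actD p q y : poly_act (p + q) y = poly_act p y + poly_act q y.
Proof.
have szD := size_polyD p q.
rewrite (poly_act_widen y szD) (poly_act_widen y (leq_maxl (size p) (size q))).
rewrite (poly_act_widen y (leq_maxr (size p) (size q))) -big_split /=.
by apply: eq_bigr => k _; rewrite coefD scalerDl.
Qed.

Lemma poly_actC c y : poly_act c%:P y = c *: y.
Proof.
by rewrite (poly_act_widen y (size_polyC_leq1 c)) big_ord1 coefC.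
Qed.

Lemma poly_actMX p y : poly_act (p * 'X) y = poly_act p (T y).
Proof.
have [->|p0] := eqVneq p 0; first by rewrite mul0r /poly_act size_poly0 !big_ord0.
rewrite /poly_act size_mulX // big_ord_recl coefMX eqxx scale0r add0r.
by apply: eq_bigr => k _; rewrite coefMX /= -iterS iterSr.
Qed.

Lemma poly_act_linear p : linear (poly_act p).
Proof.
move=> c x y; rewrite /poly_act scaler_sumr -big_split /=; apply: eq_bigr => k _.
have -> : iter k T (c *: x + y) = c *: iter k T x + iter k T y.
  by elim: (nat_of_ord k) => //= j ->; rewrite linearP.
by rewrite scalerDr !scalerA mulrC.
Qed.
HB.instance Definition _ p := GRing.isLinear.Build K V V _ (poly_act p) (poly_act_linear p).

Lemma poly_act_comm p y : T (poly_act p y) = poly_act p (T y).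
Proof.
rewrite /poly_act linear_sum /=; apply: eq_bigr => k _.
by rewrite linearZ /= -iterS iterSr.
Qed.

Lemma poly_actM p q y : poly_act (p * q) y = poly_act p (poly_act q y).
Proof.
elim/poly_ind: p y => [|p c IHp] y; first by rewrite mul0r !poly_actC !scale0r.
rewrite mulrDl mulrAC !poly_actD !poly_actMX IHp poly_act_comm; congr (_ + _).
rewrite poly_actC (poly_act_widen _ (leq_trans (size_polyMleq _ _) _ :
    (size (c%:P * q)%R <= size q)%N)).
  by rewrite /poly_act scaler_sumr; apply: eq_bigr => k _; rewrite coefCM scalerA.
by rewrite -subn1 leq_subLR; apply: leq_add (size_polyC_leq1 c) (leqnn _).
Qed.

Lemma poly_act_dvd p q y : p %| q -> poly_act p y = 0 -> poly_act q y = 0.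
Proof. by case/dvdpP => r -> p0; rewrite poly_actM p0 linear0. Qed.

Lemma poly_act_XsubC v k y :
  poly_act (('X - v%:P) ^+ k) y = iter k (fun z => T z - v *: z) y.
Proof.
elim: k y => [|k IHk] y; first by rewrite expr0 poly_actC scale1r.
rewrite exprSr poly_actM IHk iterSr; congr (iter _ _ _).
by rewrite poly_actD -['X]mul1r poly_actMX poly_actC scale1r -polyCN poly_actC scaleNr.
Qed.

End PolyAction.

Lemma mx_iterX (K : fieldType) n (A : 'M[K]_n.+1) m : iter m (mulmx A) 1%:M = A ^+ m.
Proof. by elim: m => //= m ->; rewrite exprS. Qed.

Lemma comm_alg_scalar (K : fieldType) (A : algType K) (y : A) (c : K) : GRing.comm y c%:A.
Proof. by rewrite /GRing.comm -scalerAr -scalerAl mulr1 mul1r. Qed.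

Section CartanSplit.
Variables (K : fieldType) (n : nat) (a : 'M[K]_n.+1).

Definition admx (y : 'M[K]_n.+1) : 'M[K]_n.+1 := a * y - y * a.
Lemma admx_linear : linear admx.
Proof. by move=> c x y; rewrite /admx mulrDr mulrDl scalerBr -scalerAl -scalerAr addrACA opprD. Qed.
HB.instance Definition _ := GRing.isLinear.Build K _ _ _ admx admx_linear.

(** The operator ad a - (x - y) is left multiplication by A = a - x minus right multiplication by B
    = a - y. These commute, so each term of its 2N-th power has at least N factors on one side; [p]
    and [q] count those already produced. *)
Lemma admx_block_nilp N x y z :
  (a - x%:A) ^+ N * z = 0 -> z * (a - y%:A) ^+ N = 0 ->
  iter (N + N) (fun z => admx z - (x - y) *: z) z = 0.
Proof.
move=> zx zy; set A := a - x%:A in zx *; set B := a - y%:A in zy *.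
suff H k : forall p q, (N + N <= p + q + k)%N ->
    A ^+ p * iter k (fun z => admx z - (x - y) *: z) z * B ^+ q = 0.
  have := H (N + N)%N 0%N 0%N; rewrite expr0 mul1r expr0 mulr1; apply.
  exact: leq_addl.
elim: k => [|k IHk] p q; rewrite ?addn0.
  have [leNp _|ltpN le2] := leqP N p.
    by rewrite -(subnK leNp) exprD -!mulrA (mulrA _ z) zx mul0r mulr0.
  have leNq : (N <= q)%N by rewrite -(leq_add2l N); apply: leq_trans le2 _; rewrite leq_add2r ltnW.
  by rewrite -(subnKC leNq) exprD mulrA -(mulrA _ z) zy mulr0 mul0r.
move=> le2; rewrite iterS; set w := iter k _ z.
have -> : admx w - (x - y) *: w = A * w - w * B.
  rewrite /admx /A /B mulrBl mulrBr -!scalerAl -!scalerAr mul1r mulr1 scalerBl.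
  by rewrite !opprB [y *: w - _]addrC addrACA [- (w * a) + _]addrC.
rewrite mulrBr mulrBl !mulrA -exprSr IHk ?sub0r; last first.
  by rewrite addSn addSnnS.
by rewrite -(mulrA _ B) -exprS IHk ?oppr0 // addnS addSnnS.
Qed.

Hypothesis char0 : [pchar K] =i pred0.
Variables (s : seq K).
Hypothesis split_a : char_poly a = \prod_(x <- s) ('X - x%:P).

Let es := undup s.
(** [N] exceeds every multiplicity; being a successor, it also makes ['X] divide ['X ^+ (N + N)]. *)
Let N := (size s).+1.
Let x (i : 'I_(size es)) := es`_i.

Let x_inj : injective x.
Proof. by move=> i j /eqP; rewrite nth_uniq ?undup_uniq // => /eqP/val_inj. Qed.

Let annih p : (forall i, ('X - (x i)%:P) ^+ N %| p) -> horner_mx a p = 0.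
Proof.
move=> H; have : \prod_(y <- es) ('X - y%:P) ^+ N %| p.
  apply: dvdp_prod_uniq; first exact: undup_uniq.
  by move=> y yes; have := H (Ordinal (etrans (index_mem y es) yes)); rewrite /x /= nth_index.
have : char_poly a %| \prod_(y <- es) ('X - y%:P) ^+ N.
  rewrite split_a -prodr_undup_exp_count.
  apply: (big_ind2 (fun p q => p %| q)); first exact: dvdpp.
  - by move=> p1 q1 p2 q2; apply: dvdp_mul.
  - by move=> y _; apply: dvdp_exp2l; rewrite /N leqW ?count_size.
move=> d1 d2; have /dvdpP[q ->] := dvdp_trans d1 d2.
by rewrite rmorphM /= Cayley_Hamilton mulr0.
Qed.

(** The [E i] are the projections onto the generalised eigenspaces, built as polynomials in [a]. *)
Lemma spectral_projections : exists E : 'I_(size es) -> 'M[K]_n.+1,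
  [/\ \sum_i E i = 1, forall i j, E i * E j = (i == j)%:R *: E i,
      forall i, E i * (a - (x i)%:A) ^+ N = 0 & forall i, GRing.comm a (E i)].
Proof.
have ue : uniq es by exact: undup_uniq.
pose P i p := forall y, y \in es -> ('X - y%:P) ^+ N %| p - ((y == x i)%:R : K)%:P.
have [e eP] : exists e : 'I_(size es) -> {poly K}, forall i, P i (e i).
  by apply: (fin_all_exists (P := P)) => i; apply: (@poly_crt _ N (fun y => (y == x i)%:R) _ ue).
have eP' i j : ('X - (x j)%:P) ^+ N %| e i - ((i == j)%:R : K)%:P.
  by have := eP i (x j) (mem_nth _ (ltn_ord j)); rewrite (inj_eq x_inj) eq_sym.
have e0 i j : i != j -> ('X - (x j)%:P) ^+ N %| e i.
  by move/negbTE=> ij; have := eP' i j; rewrite ij subr0.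
have e1 i : ('X - (x i)%:P) ^+ N %| e i - 1 by have := eP' i i; rewrite eqxx.
exists (fun i => horner_mx a (e i)); split.
- rewrite -rmorph_sum /= -[RHS](rmorph1 (horner_mx a)); apply/eqP; rewrite -subr_eq0 -rmorphB.
  apply/eqP/annih => j; rewrite (bigD1 j) //= addrAC dvdp_add // big_seq_cond.
  apply: (big_ind (dvdp _)) => [|p q|i /andP[_ ij]]; [exact: dvdp0|exact: dvdp_add|exact: e0].
- move=> i j; rewrite -rmorphM; have [->|ij] := eqVneq i j; last first.
    rewrite scale0r; apply: annih => k; have [ki|ki] := eqVneq i k.
      by apply/dvdp_mull/e0; rewrite -ki eq_sym.
    by apply/dvdp_mulr/e0.
  rewrite scale1r; apply/eqP; rewrite -subr_eq0 -rmorphB /=; apply/eqP/annih => k.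
  have -> : e j * e j - e j = e j * (e j - 1) by ring.
  have [->|jk] := eqVneq j k.
    exact/dvdp_mull/e1.
  exact/dvdp_mulr/e0.
- move=> i; have -> : a - (x i)%:A = horner_mx a ('X - (x i)%:P).
    by rewrite rmorphB /= horner_mx_X horner_mx_C scalemx1.
  rewrite -rmorphXn -rmorphM /=; apply: annih => k; have [->|ik] := eqVneq i k.
    exact: dvdp_mull.
  exact/dvdp_mulr/e0.
- by move=> i; rewrite -{1}(horner_mx_X a); apply: comm_horner_mx2.
Qed.

(** For a Q-linear functional f on the eigenvalues, let U be the sum of the f(x_i) E_i. Then ad U =
    P(ad a) for a polynomial P without constant term, so tr(U a), which is the sum of the tr((ad
    U)(b_i) c_i), vanishes. But tr(U a) is also the sum of the f(x_i) x_i w_i, with w_i the rank of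
    E_i, and the lemma on rational functionals leaves only the eigenvalue 0. *)
Lemma cartan_split (I : eqType) (r : seq I) (b c : I -> 'M[K]_n.+1) :
  a = \sum_(i <- r) (b i * c i - c i * b i) ->
  (forall i k, i \in r -> \tr (iter k.+1 admx (b i) * c i) = 0) ->
  exists m, a ^+ m = 0.
Proof.
move=> aE tr0; have [E [sumE EE EN Ecomm]] := spectral_projections.
pose w i := \rank (E i).
have trE i : \tr (E i) = (w i)%:R by apply: mxtrace_idem; have := EE i i; rewrite eqxx scale1r.
have trEa i : \tr (E i * a) = x i * (w i)%:R.
  have -> : E i * a = E i * (a - (x i)%:A) + x i *: E i.
    by rewrite mulrBr -scalerAr mulr1 subrK.
  rewrite mxtraceD mxtraceZ trE (@mxtrace_nilp _ N.+1) ?add0r // mx_iterX exprMn_comm.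
    by rewrite (exprSr (E i) N) (exprSr _ N) mulrA -(mulrA _ (E i)) EN mulr0 mul0r.
  by apply: commrB; [apply/commr_sym/Ecomm | apply/comm_alg_scalar].
suff H i : w i = 0%N \/ x i = 0.
  exists N; rewrite -[_ ^+ N]mul1r -sumE mulr_suml big1 // => i _.
  have [/eqP|x0] := H i.
    by rewrite /w mxrank_eq0 => /eqP ->; rewrite mul0r.
  by have := EN i; rewrite x0 scale0r subr0.
move: i; apply: (rational_functionals char0) => f fP.
(* Since [f] respects rational relations, f i - f j depends only on x i - x j; this makes the
   interpolation data [v] well defined. *)
have fdiff i j k l : x i - x j = x k - x l ->
    ratK K (f i) - ratK K (f j) = ratK K (f k) - ratK K (f l).
  pose rl t : rat := (t == i)%:R - (t == j)%:R - ((t == k)%:R - (t == l)%:R).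
  have sumr (R : pzRingType) (h : 'I_(size es) -> R) (t : 'I_(size es))
      : \sum_u (u == t)%:R * h u = h t.
    rewrite (bigD1 t) //= eqxx mul1r big1 ?addr0 // => u /negbTE ->; exact: mul0r.
  have ratKb (b' : bool) : ratK K b'%:R = b'%:R by case: b'; rewrite ?(ratK1, ratK0).
  move=> e; have /fP : \sum_t ratK K (rl t) * x t = 0.
    under eq_bigr => t _ do rewrite !(ratK_sub char0) !ratKb !mulrBl.
    by rewrite !sumrB !sumr e subrr.
  under eq_bigr => t _ do rewrite /rl !mulrBl.
  rewrite !sumrB !sumr => /eqP; rewrite subr_eq0 => /eqP ef.
  by rewrite -!(ratK_sub char0) ef.
pose v z := if [pick ij | x ij.1 - x ij.2 == z] is Some ij
  then ratK K (f ij.1) - ratK K (f ij.2) else 0.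
have vE i j : v (x i - x j) = ratK K (f i) - ratK K (f j).
  rewrite /v; case: pickP => [[k l] /= /eqP/fdiff // |/(_ (i, j))].
  by rewrite eqxx.
have v0 : v 0 = 0.
  rewrite /v; case: pickP => [[k l] /= /eqP|] // e.
  by rewrite (fdiff k l k k) ?subrr.
(* The node 0, where [v] is 0, is there to remove the constant term of [P]. The exponent [N + N]
   used next is the one at which ad a - (x i - x j) dies on the block E i z E j. *)
pose nodes := undup (0 :: [seq y - z | y <- es, z <- es]).
have [P PP] := poly_crt (N + N) v (undup_uniq (0 :: [seq y - z | y <- es, z <- es])).
have PE i j z : poly_act admx P (E i * z * E j) = (ratK K (f i) - ratK K (f j)) *: (E i * z * E j).
  rewrite -vE -(subrK (v (x i - x j))%:P P) poly_actD poly_actC -[RHS]add0r; congr (_ + _).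
  have mem : x i - x j \in nodes.
    rewrite mem_undup inE; apply/orP; right.
    by apply: (allpairs_f (fun y z => y - z)); apply: mem_nth.
  apply: (poly_act_dvd (PP _ mem)); rewrite poly_act_XsubC.
  have comm k l : GRing.comm (E k) ((a - (x l)%:A) ^+ N).
    by apply: commrX; apply: commrB; [apply/commr_sym/Ecomm | apply/comm_alg_scalar].
  apply: admx_block_nilp; first by rewrite !mulrA -(comm i) EN !mul0r.
  by rewrite -!mulrA EN !mulr0.
pose U := \sum_i ratK K (f i) *: E i.
have UP y : U * y - y * U = poly_act admx P y.
  have UE i : U * E i = ratK K (f i) *: E i.
    rewrite /U mulr_suml (bigD1 i) //= big1 => [|j /negbTE ji]; rewrite -scalerAl EE.
      by rewrite eqxx scale1r addr0.
    by rewrite ji scale0r scaler0.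
  have EU i : E i * U = ratK K (f i) *: E i.
    rewrite /U mulr_sumr (bigD1 i) //= big1 => [|j /negbTE ji]; rewrite -scalerAr EE.
      by rewrite eqxx scale1r addr0.
    by rewrite eq_sym ji scale0r scaler0.
  have yE : y = \sum_i \sum_j E i * y * E j.
    rewrite -[LHS]mul1r -{1}sumE mulr_suml; apply: eq_bigr => i _.
    by rewrite -[LHS]mulr1 -{1}sumE mulr_sumr.
  rewrite [in LHS]yE [in RHS]yE mulr_sumr mulr_suml -sumrB linear_sum /=.
  apply: eq_bigr => i _; rewrite mulr_sumr mulr_suml -sumrB linear_sum /=.
  apply: eq_bigr => j _; rewrite PE -[E i * y * E j * U]mulrA EU !mulrA UE.
  by rewrite -!scalerAl -scalerAr scalerBl.
have /dvdpP[Q PQ] : 'X %| P.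
  have mem : 0 \in nodes by rewrite mem_undup mem_head.
  have := PP _ mem; rewrite v0 !subr0; apply: dvdp_trans.
  by rewrite addSn exprS dvdp_mulIl.
transitivity (\tr (U * a)).
  rewrite /U mulr_suml raddf_sum /=; apply: eq_bigr => i _.
  by rewrite -scalerAl mxtraceZ trEa mulrA.
rewrite aE mulr_sumr raddf_sum /= big_seq big1 // => i ir.
have -> : \tr (U * (b i * c i - c i * b i)) = \tr ((U * b i - b i * U) * c i).
  rewrite mulrBr mulrBl !raddfB /= !mulrA; congr (_ - _).
  by rewrite [LHS]mxtrace_mulC mulmxE mulrA.
rewrite UP PQ poly_actMX /poly_act mulr_suml raddf_sum /= big1 // => k _.
by rewrite -scalerAl mxtraceZ -iterSr tr0 // mulr0.
Qed.

End CartanSplit.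

(* Besides Cartan's criterion, where the trace form vanishes on a Lie algebra
   containing the [b i] and [c i], this covers the case where each [c i] commutes
   with [a]: then tr([a, y] c) = tr(y [c, a]) = 0. *)
Lemma cartan_mx (F : fieldType) n (a : 'M[F]_n) (I : eqType) (r : seq I) (b c : I -> 'M[F]_n) :
  [pchar F] =i pred0 ->
  a = \sum_(i <- r) (b i *m c i - c i *m b i) ->
  (forall i k, i \in r -> \tr (iter k.+1 (fun y => a *m y - y *m a) (b i) *m c i) = 0) ->
  exists m, iter m (mulmx a) 1%:M = 0.
Proof.
case: n a b c => [|n] a b c char0 aE tr0.
  by exists 0%N; rewrite [LHS]thinmx0.
have [K [f [s sP]]] := splitting_extension (leqnn _) (char_poly_monic a).
have charK : [pchar K] =i pred0 by move=> p; rewrite (fmorph_pchar f) char0.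
rewrite map_char_poly in sP.
have [||m m0] := @cartan_split K n (map_mx f a) charK s sP I r (fun i => map_mx f (b i))
    (fun i => map_mx f (c i)).
- rewrite {1}aE raddf_sum; apply: eq_bigr => i _.
  by rewrite raddfB /= !map_mxM.
- move=> i k ir; rewrite -mulmxE.
  have -> : iter k.+1 (admx (map_mx f a)) (map_mx f (b i)) =
    map_mx f (iter k.+1 (fun y => a *m y - y *m a) (b i)).
    by elim: k.+1 => // j /= ->; rewrite /admx raddfB /= !map_mxM.
  by rewrite -map_mxM trace_map_mx tr0 // rmorph0.
exists m; rewrite mx_iterX; apply/eqP; rewrite -(map_mx_eq0 f).
by rewrite rmorphXn /= m0.
Qed.

(** * Operators and Engel's theorem *)

Section MaxDim.
Variables (F : fieldType) (V : vectType F).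

Lemma ex_max_vspace (P : {vspace V} -> Prop) U0 : P U0 ->
  exists U, [/\ P U, (U0 <= U)%VS & forall W, P W -> (U <= W)%VS -> W = U].
Proof.
have [k] := ubnP (\dim {:V} - \dim U0)%N; elim: k U0 => // k IHk U0 lek PU0.
have [[W [PW U0W neW]]|H] := classic (exists W, [/\ P W, (U0 <= W)%VS & W <> U0]); last first.
  exists U0; split=> // W PW U0W; apply: NNPP => neW; apply: H.
  by exists W.
have ltd : (\dim U0 < \dim W)%N.
  rewrite ltn_neqAle dimvS // andbT; apply/eqP => e; apply: neW; apply/esym/eqP.
  by rewrite eqEdim U0W e /=.
have [|//|U [PU WU Umax]] := IHk W; last by exists U; split=> //; apply: subv_trans WU.
apply: leq_trans (_ : \dim {:V} - \dim U0 <= k)%N; last by [].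
by apply: ltn_sub2l => //; apply: leq_trans ltd (dimvS (subvf _)).
Qed.

Lemma ex_min_vspace (P : {vspace V} -> Prop) U0 : P U0 ->
  exists U, [/\ P U, (U <= U0)%VS & forall W, P W -> (W <= U)%VS -> W = U].
Proof.
have [k] := ubnP (\dim U0)%N; elim: k U0 => // k IHk U0 lek PU0.
have [[W [PW U0W neW]]|H] := classic (exists W, [/\ P W, (W <= U0)%VS & W <> U0]); last first.
  exists U0; split=> // W PW U0W; apply: NNPP => neW; apply: H.
  by exists W.
have ltd : (\dim W < \dim U0)%N.
  rewrite ltn_neqAle dimvS // andbT; apply/eqP => e; apply: neW; apply/eqP.
  by rewrite eqEdim U0W e /=.
have [|//|U [PU WU Umin]] := IHk W; first exact: leq_trans ltd lek.
by exists U; split=> //; apply: subv_trans WU _.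
Qed.

End MaxDim.

Section Operators.
Variables (F : fieldType) (V : vectType F).
Implicit Types f g h : 'End(V).

Definition lbr f g : 'End(V) := ((f \o g) - (g \o f))%VF.

Lemma lbrE f g v : lbr f g v = f (g v) - g (f v).
Proof. by rewrite /lbr add_lfunE opp_lfunE !comp_lfunE. Qed.

Lemma lbr_is_bilinear : bilinear_for *:%R *:%R lbr.
Proof.
by split=> [g|f] k x y; apply/lfunP => v;
   rewrite !(lbrE, lfun_simp) linearP; rewrite scalerBr opprD addrACA.
Qed.
HB.instance Definition _ := bilinear_isBilinear.Build F
  'End(V) 'End(V) 'End(V) *:%R *:%R lbr lbr_is_bilinear.

Definition nilop f := exists m, forall v, iter m f v = 0.

(** The transpose undoes the row-vector convention, so that composition becomes matrix
    multiplication in the same order. *)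
Definition lmx f := (mxof (vbasis {:V}) (vbasis {:V}) f)^T.

Lemma lmx_linear : linear lmx.
Proof. by move=> k f g; rewrite /lmx !linearP. Qed.
HB.instance Definition _ := GRing.isLinear.Build F _ _ _ lmx lmx_linear.

Lemma lmx_comp f g : lmx (f \o g)%VF = lmx f *m lmx g.
Proof.
by rewrite /lmx (@mxof_comp _ _ _ _ _ (vbasis {:V})) ?vbasisP // trmx_mul.
Qed.

Lemma lmx_eq0 f : (lmx f == 0) = (f == 0).
Proof. by rewrite /lmx trmx_eq0 mxof_eq0 ?vbasisP. Qed.

Lemma lmx1 : lmx \1%VF = 1%:M.
Proof. by rewrite /lmx mxof1 ?trmx1 // (basis_free (vbasisP _)). Qed.

Definition ltrace f := \tr (lmx f).

Lemma ltrace_is_scalar : scalar ltrace.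
Proof. by move=> k f g; rewrite /ltrace linearP mxtraceD mxtraceZ. Qed.
HB.instance Definition _ := GRing.isLinear.Build F _ _ _ ltrace ltrace_is_scalar.

Lemma ltraceC f g : ltrace (f \o g)%VF = ltrace (g \o f)%VF.
Proof. by rewrite /ltrace !lmx_comp mxtrace_mulC. Qed.

Lemma ltrace_lbr f g h : ltrace (lbr f g \o h)%VF = ltrace (f \o lbr g h)%VF.
Proof.
rewrite /lbr comp_lfunDl comp_lfunDr comp_lfunNl comp_lfunNr !linearB /=.
by rewrite -!comp_lfunA; congr (_ - _); rewrite ltraceC comp_lfunA.
Qed.

Lemma lfun_cartan (char0 : [pchar F] =i pred0) (a : 'End(V)) (I : eqType) (r : seq I) (b c :
    I -> 'End(V)) :
  a = \sum_(i <- r) lbr (b i) (c i) ->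
  (forall i k, i \in r -> ltrace (iter k.+1 (lbr a) (b i) \o c i)%VF = 0) ->
  nilop a.
Proof.
move=> aE tr0; have [||m m0] := @cartan_mx F _ (lmx a) I r (lmx \o b) (lmx \o c) char0.
- by rewrite {1}aE linear_sum /=; apply: eq_bigr => i _; rewrite linearB /= !lmx_comp.
- move=> i k ir; rewrite /=.
  suff -> j : iter j (fun y => lmx a *m y - y *m lmx a) (lmx (b i)) = lmx (iter j (lbr a) (b i)).
    by rewrite -!lmx_comp -linearB /= -lmx_comp; apply: (tr0 i k ir).
  by elim: j => //= j ->; rewrite linearB /= !lmx_comp.
exists m => v; have : iter m (comp_lfun a) \1%VF = 0.
  apply/eqP; rewrite -lmx_eq0 -m0; apply/eqP.
  by elim: m {m0} => [|m IHm]; rewrite /= ?lmx1 // lmx_comp IHm.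
move/lfunP/(_ v); rewrite zero_lfunE => <-.
by elim: m {m0} => [|m IHm]; rewrite /= ?id_lfunE // comp_lfunE IHm.
Qed.

Definition opv (G : {vspace 'End(V)}) (U : {vspace V}) : {vspace V} :=
  (\sum_(i < \dim G) (vbasis G)`_i @: U)%VS.

Lemma opvP (G : {vspace 'End(V)}) (U W : {vspace V}) :
  reflect (forall g u, g \in G -> u \in U -> g u \in W) (opv G U <= W)%VS.
Proof.
apply: (iffP subv_sumP) => [H g u /coord_vbasis -> uU | H i _].
  rewrite sum_lfunE rpred_sum // => i _; rewrite scale_lfunE rpredZ //.
  by apply: (subvP (H i isT)); apply: memv_img.
apply/subvP => _ /memv_imgP[u uU ->]; apply: H => //.
by apply/vbasis_mem/mem_nth; rewrite size_tuple.
Qed.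

Lemma memv_opv (G : {vspace 'End(V)}) (U : {vspace V}) g u : g \in G -> u \in U -> g u \in opv G U.
Proof. by move: g u; apply/(@opvP G U (opv G U)). Qed.

Lemma opvS (G H : {vspace 'End(V)}) (U W : {vspace V}) : (G <= H)%VS -> (U <= W)%VS ->
    (opv G U <= opv H W)%VS.
Proof.
move=> /subvP GH /subvP UW; apply/opvP => g u gG uU; apply: memv_opv; auto.
Qed.

Definition oplcs (G : {vspace 'End(V)}) k := iter k (opv G) {:V}%VS.

Lemma oplcsS G k : (oplcs G k.+1 <= oplcs G k)%VS.
Proof.
by elim: k => [|k IHk]; [apply: subvf | apply: opvS].
Qed.

Lemma oplcs_leq G j k : (j <= k)%N -> (oplcs G k <= oplcs G j)%VS.
Proof.
elim: k => [|k IHk]; first by rewrite leqn0 => /eqP ->.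
by rewrite leq_eqVlt ltnS => /predU1P[-> // | /IHk]; apply: subv_trans; apply: oplcsS.
Qed.

Definition opnilp (G : {vspace 'End(V)}) := exists m, oplcs G m = 0%VS.

(* If all products of [m] elements of [H] vanish, then [2m] brackets with
   elements of [H] kill any operator: each term has at least [m] factors from
   [H] on one side. *)
Lemma engel_normalizer (G H : {vspace 'End(V)}) m :
  (forall f g, f \in G -> g \in G -> lbr f g \in G) -> (H <= G)%VS -> ~~ (G <= H)%VS ->
  oplcs H m = 0%VS ->
  exists g, [/\ g \in G, g \notin H & forall h, h \in H -> lbr h g \in H].
Proof.
move=> Glie HG nGH m0; apply: NNPP => Hno.
have step g : g \in G -> g \notin H -> exists2 h, h \in H & lbr h g \notin H.
  move=> gG gH; apply: NNPP => no; apply: Hno; exists g; split=> // h hH.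
  by apply: contraT => nh; case: no; exists h.
have [g0 g0G g0H] : exists2 g, g \in G & g \notin H by apply/subvPn.
have seqg k : exists g, [/\ g \in G, g \notin H &
    forall j u, (j <= m)%N -> u \in oplcs H j -> g u \in oplcs H (k + j - m)].
  elim: k => [|k [g [gG gH gP]]].
    exists g0; split=> // j u jm _.
    by move: jm; rewrite -subn_eq0 => /eqP ->; apply: memvf.
  have [h hH nh] := step g gG gH; exists (lbr h g); split=> //.
    by apply: Glie => //; apply: (subvP HG).
  move=> j u jm uj; rewrite lbrE rpredB //.
    apply: (subvP (oplcs_leq H (_ : _ <= (k + j - m).+1)%N)).
      by rewrite addSn leq_subLR addnS ltnS -leq_subLR.
    by apply: memv_opv => //; apply: gP.
  have hu : h u \in oplcs H j.+1 by apply: memv_opv.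
  have [jlt|jge] := ltnP j m; first by rewrite addSnnS; apply: gP.
  have -> : h u = 0.
    by apply/eqP; rewrite -memv0 -m0; apply: (subvP (oplcs_leq H (_ : m <= j.+1)%N)) hu;
        rewrite leqW.
  by rewrite linear0 mem0v.
have [g [_ gH gP]] := seqg (m + m)%N.
case/negP: gH; suff -> : g = 0 by apply: mem0v.
apply/lfunP => u; rewrite zero_lfunE; apply/eqP; rewrite -memv0 -m0.
by have := gP 0%N u (leq0n _) (memvf _); rewrite addn0 addnK.
Qed.

(** Each [oplcs H j] is stable under [g], because gh = hg - [h, g]. Modulo [oplcs H j.+1] only [g]
    acts on it, so [p] steps, with [p] a nilpotency exponent of [g], lead into the next term. *)
Lemma engel_extend (H : {vspace 'End(V)}) g m :
  oplcs H m = 0%VS -> nilop g -> (forall h, h \in H -> lbr h g \in H) ->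
  opnilp (H + <[g]>)%VS.
Proof.
move=> m0 [p gp] Hg; set G := (H + <[g]>)%VS.
have GP (W W' : {vspace V}) : (forall h u, h \in H -> u \in W -> h u \in W') ->
    (forall u, u \in W -> g u \in W') -> (opv G W <= W')%VS.
  move=> hP gP; apply/opvP => _ u /memv_addP[h hH [_ /vlineP[k ->] ->]] uW.
  by rewrite add_lfunE; apply: rpredD; [exact: hP | rewrite scale_lfunE rpredZ ?gP].
have gstab j u : u \in oplcs H j -> g u \in oplcs H j.
  elim: j u => [|j IHj] u; first by move=> _; apply: memvf.
  have : (opv H (oplcs H j) <= (g @^-1: oplcs H j.+1))%VS.
    apply/opvP => h w hH wj; rewrite -memv_preim.
    have -> : g (h w) = h (g w) - lbr h g w by rewrite lbrE subKr.
    by rewrite rpredB // memv_opv ?Hg ?IHj.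
  by move=> /subvP H1 /H1; rewrite -memv_preim.
have drop j : exists k, (oplcs G k <= oplcs H j)%VS.
  elim: j => [|j [k kj]]; first by exists 0%N.
  exists (p + k)%N; rewrite /oplcs iterD.
  suff H1 i : (iter i (opv G) (oplcs G k) <= (iter i (lfun_img g) (oplcs H j) + oplcs H j.+1))%VS.
    apply: subv_trans (H1 p) _; rewrite subv_add subvv andbT.
    suff -> : iter p (lfun_img g) (oplcs H j) = 0%VS by apply: sub0v.
    apply/eqP; rewrite -subv0; apply/subvP => u.
    have : forall q u, u \in iter q (lfun_img g) (oplcs H j) -> exists w, u = iter q g w.
      elim=> [|q IHq] w /=; first by exists w.
      by case/memv_imgP => w' /IHq[w2 ->] ->; exists w2.
    by move=> H2 /H2[w ->]; rewrite gp mem0v.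
  elim: i => [|i IHi] /=; first by apply: subv_trans kj (addvSl _ _).
  apply: subv_trans (opvS (subvv _) IHi) _.
  have sub : (iter i (lfun_img g) (oplcs H j) <= oplcs H j)%VS.
    elim: i {IHi} => [|i IHi] //=; apply/subvP => _ /memv_imgP[u /(subvP IHi) ui ->].
    exact: gstab.
  apply: GP => [h u hH|u] /memv_addP[u1 u1P [u2 u2P ->]]; rewrite linearD.
    apply: (subvP (addvSr _ _)); apply: rpredD; apply: memv_opv => //.
      exact: (subvP sub).
    exact: (subvP (oplcsS _ _)).
  by apply: memv_add; [apply: memv_img | exact: (gstab j.+1)].
have [k km] := drop m; exists k; apply/eqP; by rewrite -subv0 -m0.
Qed.

(** Take a maximal subspace [H] of [G] that is closed under brackets and nilpotent. If it were
    proper, some [g] outside [H] would normalise it, and [H + <[g]>] would be larger. *)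
Lemma engel (G : {vspace 'End(V)}) :
  (forall f g, f \in G -> g \in G -> lbr f g \in G) -> (forall g, g \in G -> nilop g) ->
  opnilp G.
Proof.
move=> Glie Gnil.
pose P (H : {vspace 'End(V)}) := [/\ (H <= G)%VS, forall f g, f \in H -> g \in H ->
    lbr f g \in H & opnilp H].
have P0 : P 0%VS.
  split; first exact: sub0v.
    by move=> f g; rewrite !memv0 => /eqP -> _; rewrite linear0l.
  exists 1%N; apply/eqP; rewrite -subv0; apply/opvP => g u; rewrite !memv0 => /eqP -> _.
  by rewrite lfun_simp.
have [H [[HG Hlie [m m0]] _ Hmax]] := ex_max_vspace P0.
have [GH|nGH] := boolP (G <= H)%VS.
  have -> : G = H by apply/eqP; rewrite eqEsubv GH HG.
  by exists m.
have [g [gG gH Hg]] := engel_normalizer Glie HG nGH m0.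
have /Hmax : P (H + <[g]>)%VS.
  split; last exact: engel_extend m0 (Gnil g gG) Hg.
    by rewrite subv_add HG -memvE.
  move=> _ _ /memv_addP[h1 h1H [_ /vlineP[k1 ->] ->]] /memv_addP[h2 h2H [_ /vlineP[k2 ->] ->]].
  apply: (subvP (addvSl _ _)).
  have gg : lbr g g = 0 by rewrite /lbr subrr.
  have gh h : h \in H -> lbr g h \in H.
    move=> hH; have -> : lbr g h = - lbr h g by rewrite /lbr opprB.
    by rewrite rpredN Hg.
  rewrite linearDl !linearDr /= !linearZl_LR !linearZr_LR /= gg !scaler0 addr0.
  by apply: rpredD; [apply: rpredD; [exact: Hlie | rewrite rpredZ ?Hg] | rewrite rpredZ ?gh].
move=> /(_ (addvSl _ _)) e; case/negP: gH; rewrite -e.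
by apply: (subvP (addvSr _ _)); apply: memv_line.
Qed.

End Operators.

(** * Representations and the first Whitehead lemma *)

(** A maximal subspace inside [P] absorbs the line of each vector of [P]. Radicals and annihilators
    become subspaces this way. *)
Lemma vspace_of_pred (F : fieldType) (V : vectType F) (P : V -> Prop) :
  P 0 -> (forall k x y, P x -> P y -> P (k *: x + y)) ->
  exists U : {vspace V}, forall x, x \in U <-> P x.
Proof.
move=> P0 PD; pose Q (U : {vspace V}) := forall x, x \in U -> P x.
have Q0 : Q 0%VS by move=> x; rewrite memv0 => /eqP ->.
have [U [QU _ Umax]] := ex_max_vspace Q0.
exists U => x; split=> [/QU // | Px].
have /Umax : Q (<[x]> + U)%VS.
  by move=> _ /memv_addP[_ /vlineP[k ->] [u uU ->]]; apply: PD => //; apply: QU.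
by move=> <-; [apply: (subvP (addvSl _ _)); apply: memv_line | apply: addvSr].
Qed.

Lemma prodvs_sum (F : fieldType) (L : vectType F) (mu : {bilinear L -> L -> L}) (U W :
    {vspace L}) z :
  z \in prodvs mu U W -> exists r : seq (L * L),
    (forall p, p \in r -> p.1 \in U /\ p.2 \in W) /\ z = \sum_(p <- r) mu p.1 p.2.
Proof.
pose P z := exists r : seq (L * L),
    (forall p, p \in r -> p.1 \in U /\ p.2 \in W) /\ z = \sum_(p <- r) mu p.1 p.2.
have [||T TP] := @vspace_of_pred _ L P.
- by exists [::]; rewrite big_nil.
- move=> k _ _ [r1 [r1P ->]] [r2 [r2P ->]].
  exists ([seq (k *: p.1, p.2) | p <- r1] ++ r2); split.
    move=> p; rewrite mem_cat => /orP[/mapP[q /r1P[q1 q2] ->] /=|/r2P //].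
    by rewrite memvZ.
  rewrite big_cat big_map /= scaler_sumr; congr (_ + _).
  by apply: eq_bigr => p _; rewrite linearZl_LR.
move=> zUW; apply/TP; move: zUW; apply/subvP/prodvsP => u w uU wW; apply/TP.
exists [:: (u, w)]; rewrite big_seq1; split=> // p.
by rewrite inE => /eqP ->.
Qed.

Section Rep.
Variables (F : fieldType) (L : vectType F) (mu : {bilinear L -> L -> L}).

(** Only the left action is represented. As [f, f] = 0, such a [rho] kills every [mu x x], so it
    sees only a Lie quotient. *)
Definition is_rep (V : vectType F) (rho : {linear L -> 'End(V)}) :=
  forall x y, rho (mu x y) = lbr (rho x) (rho y).

Definition stable_rep (V : vectType F) (rho : L -> 'End(V)) (U : {vspace V}) :=
  forall x u, u \in U -> rho x u \in U.

Definition irreducible_rep (V : vectType F) (rho : L -> 'End(V)) :=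
  {:V}%VS != 0%VS /\ forall U, stable_rep rho U -> U = 0%VS \/ U = {:V}%VS.

(** * Ideals that act trivially on an irreducible module *)

Section Irreducible.
Variables (V : vectType F) (rho : {linear L -> 'End(V)}).
Hypotheses (rhoM : is_rep rho) (char0 : [pchar F] =i pred0).
Implicit Types A B I U W K : {vspace L}.

Lemma rep_iter z x k : iter k (lbr (rho z)) (rho x) = rho (iter k (mu z) x).
Proof. by elim: k => //= k ->; rewrite rhoM. Qed.

Lemma rep_nilp U W z :
  z \in prodvs mu U W ->
  (forall x y k, x \in U -> y \in W -> ltrace (rho (iter k.+1 (mu z) x) \o rho y)%VF = 0) ->
  nilop (rho z).
Proof.
case/prodvs_sum => r [rP zE] tr0.
apply: (lfun_cartan char0 (r := r) (b := fun p => rho p.1) (c := fun p => rho p.2)).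
  by rewrite {1}zE linear_sum /=; apply: eq_bigr => p _; rewrite rhoM.
by move=> p k /rP[p1 p2]; rewrite rep_iter tr0.
Qed.

Hypothesis irr : irreducible_rep rho.

(** The span of all [rho x u] with [x] in [B] is a submodule. By Engel's theorem its iteration
    reaches 0, so it is not [V], and irreducibility makes it 0. *)
Lemma engel_irreducible B :
  (forall x y, y \in B -> mu x y \in B) -> (forall x, x \in B -> nilop (rho x)) ->
  forall x, x \in B -> rho x = 0.
Proof.
move=> LB Bnil; pose G := (linfun rho @: B)%VS.
have GP g : g \in G -> exists2 x, x \in B & g = rho x.
  by case/memv_imgP=> x xB ->; exists x; rewrite ?lfunE.
have Gm x : x \in B -> rho x \in G by move=> xB; rewrite -[rho x](lfunE rho) memv_img.
have [m m0] : opnilp G.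
  apply: engel => [_ _ /GP[x xB ->] /GP[y yB ->] | _ /GP[x xB ->]].
    by rewrite -rhoM; apply/Gm/LB.
  exact: Bnil.
have inv : stable_rep rho (opv G {:V}).
  move=> x; suff /subvP H : (opv G {:V} <= rho x @^-1: opv G {:V})%VS.
    by move=> u /H; rewrite -memv_preim.
  apply/opvP => _ u /GP[y yB ->] _; rewrite -memv_preim.
  have -> : rho x (rho y u) = rho (mu x y) u + rho y (rho x u) by rewrite rhoM lbrE subrK.
  by rewrite rpredD // memv_opv ?memvf // Gm // LB.
have [V0 /(_ _ inv)[e|e]] := irr.
  move=> x xB; apply/lfunP => u; rewrite zero_lfunE; apply/eqP; rewrite -memv0 -e.
  by rewrite memv_opv ?memvf // Gm.
case/eqP: V0; rewrite -m0 /oplcs; elim: m {m0} => // m IHm.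
by rewrite iterS -IHm.
Qed.

(** By Cartan's criterion I^2 acts by nilpotent operators, and modulo [K] nothing else acts. The
    summand [K] lets one statement serve a perfect ideal ([K] zero) and an algebra perfect modulo
    [M] ([K] equal to [M]). *)
Lemma cartan_irreducible I K :
  (forall x y, y \in I -> mu x y \in I) -> (I <= prodvs mu I I + K)%VS ->
  (forall x, x \in K -> rho x = 0) ->
  (forall x y, x \in I -> y \in I -> ltrace (rho x \o rho y)%VF = 0) ->
  forall x, x \in I -> rho x = 0.
Proof.
move=> LI IK K0 tr0; apply: engel_irreducible => // x xI.
have /memv_addP[y yII [k kK xE]] := subvP IK x xI.
have -> : rho x = rho y by rewrite xE linearD /= (K0 k) // addr0.
apply: rep_nilp yII _ => u w j uI wI; apply: tr0 => //.
have itI i : iter i (mu y) u \in I by elim: i => //= i; apply: LI.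
exact: itI.
Qed.

(* First [L, A] and then [A] consist of sums of brackets with elements
   commuting with them, hence of nilpotent operators. *)
Lemma abelian_irreducible A :
  (forall x y, y \in A -> mu x y \in A) -> (A <= prodvs mu {:L} {:L})%VS ->
  (forall x y, x \in A -> y \in A -> rho (mu x y) = 0) ->
  forall x, x \in A -> rho x = 0.
Proof.
move=> LA AL2 AA.
have comm_nil U W z : z \in prodvs mu U W -> (forall y, y \in W -> rho (mu z y) = 0) ->
    nilop (rho z).
  move=> zUW zW; apply: rep_nilp zUW _ => x y k xU yW.
  rewrite iterS; move: (iter k _ x) => w.
  have -> : rho (mu z w) = - lbr (rho w) (rho z) by rewrite rhoM /lbr opprB.
  by rewrite comp_lfunNl linearN /= ltrace_lbr -rhoM zW // comp_lfun0r linear0 oppr0.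
have LAsub : (prodvs mu {:L} A <= A)%VS by apply/prodvsP => x y _; apply: LA.
have LA0 : forall x, x \in prodvs mu {:L} A -> rho x = 0.
  apply: engel_irreducible => [x y yLA|x xLA].
    by apply: memv_prodvs; rewrite ?memvf //; apply: (subvP LAsub).
  by apply: (comm_nil _ _ _ xLA) => y yA; apply: AA => //; apply: (subvP LAsub).
apply: engel_irreducible => // x xA; apply: (comm_nil _ _ _ (subvP AL2 x xA)) => y _.
have -> : rho (mu x y) = - rho (mu y x) by rewrite !rhoM /lbr opprB.
by rewrite LA0 ?oppr0 // memv_prodvs ?memvf.
Qed.

(** If the next term of the series acts as 0, the current one is abelian as far as [rho] can tell,
    so it acts as 0 too; the series is climbed back up to [A]. *)
Lemma lcs_irreducible A k :
  (forall x y, y \in A -> mu x y \in A) -> (A <= prodvs mu {:L} {:L})%VS ->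
  leibniz mu -> (forall x, x \in lcs mu A k -> rho x = 0) ->
  forall x, x \in A -> rho x = 0.
Proof.
move=> LA AL2 muL.
have lcsA j : (lcs mu A j <= A)%VS.
  elim: j => [|j IHj]; first exact: subvv.
  by apply/prodvsP => x y _ /(subvP IHj); apply: LA.
have Llcs j : forall x y, y \in lcs mu A j -> mu x y \in lcs mu A j.
  elim: j => // j IHj x; suff /subvP H : (lcs mu A j.+1 <= linfun (mu x) @^-1: lcs mu A j.+1)%VS.
    by move=> y /H; rewrite -memv_preim lfunE.
  apply/prodvsP => u w uA wA; rewrite -memv_preim lfunE /= muL.
  by rewrite rpredD // memv_prodvs ?LA ?IHj.
elim: k => // k IHk Ak; apply: IHk; apply: (@abelian_irreducible (lcs mu A k)).
  exact: Llcs.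
  exact: subv_trans (lcsA k) AL2.
move=> x y xk yk; apply: Ak; apply: memv_prodvs => //.
exact: (subvP (lcsA k)).
Qed.

End Irreducible.

Section SubQuot.
Variables (V : vectType F) (rho : {linear L -> 'End(V)}) (U : {vspace V}).

Definition sub_rep x : 'End(subvs_of U) := linfun (vsproj U \o rho x \o vsval)%FUN.

Lemma sub_rep_linear : linear sub_rep.
Proof.
move=> k x y; apply/lfunP => a; rewrite add_lfunE scale_lfunE !lfunE /=.
by rewrite linearP add_lfunE scale_lfunE linearP.
Qed.
HB.instance Definition _ := GRing.isLinear.Build F L _ _ sub_rep sub_rep_linear.

Definition quot_rep x : 'End(quotvs U) := linfun (quot_proj U \o rho x \o vsval)%FUN.

Lemma quot_rep_linear : linear quot_rep.
Proof.
move=> k x y; apply/lfunP => a; rewrite add_lfunE scale_lfunE !lfunE /=.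
by rewrite linearP add_lfunE scale_lfunE linearP.
Qed.
HB.instance Definition _ := GRing.isLinear.Build F L _ _ quot_rep quot_rep_linear.

Hypothesis invU : stable_rep rho U.

Lemma sub_repE x a : vsval (sub_rep x a) = rho x (vsval a).
Proof. by rewrite lfunE /= vsprojK // invU // subvsP. Qed.

Lemma memv_quot v : (v \in U) = (quot_proj U v == 0).
Proof. by rewrite -memv_ker quot_proj_ker. Qed.

Lemma quot_repE x v : quot_rep x (quot_proj U v) = quot_proj U (rho x v).
Proof.
rewrite lfunE /=; apply/eqP; rewrite -subr_eq0 -linearB -memv_quot /= -linearB; apply: invU.
by rewrite memv_quot linearB /= quot_reprK subrr.
Qed.

Lemma sub_rep_irreducible : U != 0%VS ->
  (forall W, stable_rep rho W -> (W <= U)%VS -> W = 0%VS \/ W = U) -> irreducible_rep sub_rep.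
Proof.
move=> U0 irrU; split; first by rewrite -dimv_eq0 dimvf dimv_eq0.
move=> W invW; pose e : 'Hom(subvs_of U, V) := linfun vsval.
have eE a : e a = vsval a by rewrite lfunE.
have [||e0|eU] := irrU (e @: W)%VS.
- move=> x _ /memv_imgP[a aW ->]; rewrite eE -sub_repE // -eE memv_img //.
  exact: invW.
- by apply/subvP => _ /memv_imgP[a aW ->]; rewrite eE subvsP.
- left; apply/eqP; rewrite -subv0; apply/subvP => a aW.
  rewrite memv0 -(inj_eq subvs_inj) /= -eE -memv0 -e0; exact: memv_img.
right; apply/eqP; rewrite eqEsubv subvf; apply/subvP => a _.
have : e a \in (e @: W)%VS by rewrite eU eE subvsP.
by case/memv_imgP => b bW; rewrite !eE => /subvs_inj ->.
Qed.

Hypothesis rhoM : is_rep rho.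

Lemma sub_is_rep : is_rep sub_rep.
Proof.
move=> x y; apply/lfunP => a; apply: subvs_inj.
by rewrite lbrE linearB /= !sub_repE rhoM lbrE.
Qed.

Lemma quot_is_rep : is_rep quot_rep.
Proof.
move=> x y; apply/lfunP => a; rewrite -(quot_reprK a).
by rewrite lbrE !quot_repE rhoM lbrE linearB.
Qed.

End SubQuot.

(** * The Casimir operator and the vanishing of first cohomology *)

Section Casimir.
Variables (M : {vspace L}).
Hypotheses (char0 : [pchar F] =i pred0)
  (maxM : forall I, ideal mu I -> (M <= I)%VS -> I = M \/ I = {:L}%VS)
  (perfM : ({:L} <= prodvs mu {:L} {:L} + M)%VS).

Section IrrCase.
Variables (V : vectType F) (rho : {linear L -> 'End(V)}) (U : {vspace V}) (v : V).
Hypotheses (rhoM : is_rep rho) (invU : stable_rep rho U) (U0 : U != 0%VS)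
  (irrU : forall W, stable_rep rho W -> (W <= U)%VS -> W = 0%VS \/ W = U)
  (M0 : forall m u, m \in M -> u \in U -> rho m u = 0)
  (Mv0 : forall m, m \in M -> rho m v = 0)
  (Uv : forall x, rho x v \in U).

Let sg : {linear L -> 'End(subvs_of U)} := sub_rep rho U.

Let sgM : is_rep sg. Proof. exact: sub_is_rep. Qed.

Let sg_irr : irreducible_rep sg. Proof. exact: sub_rep_irreducible. Qed.

Let sg0 m : m \in M -> sg m = 0.
Proof.
move=> mM; apply/lfunP => a; apply: subvs_inj.
by rewrite sub_repE // zero_lfunE linear0 M0 ?subvsP.
Qed.

Let beta x y := ltrace (sg x \o sg y)%VF.

Let betaC x y : beta x y = beta y x. Proof. exact: ltraceC. Qed.
Let beta_linr x : linear_for *%R (beta x).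
Proof.
by move=> k y z; rewrite /beta linearP comp_lfunDr -comp_lfunZr linearP.
Qed.
Let betaD x y z : beta x (y + z) = beta x y + beta x z.
Proof. by have := beta_linr x 1 y z; rewrite scale1r mul1r. Qed.
Let beta0 x : beta x 0 = 0.
Proof. by rewrite /beta linear0 comp_lfun0r linear0. Qed.
Let betaZ k x y : beta x (k *: y) = k * beta x y.
Proof. by have := beta_linr x k y 0; rewrite !addr0 beta0 addr0. Qed.
Let beta_sum x I (r : seq I) G : beta x (\sum_(i <- r) G i) = \sum_(i <- r) beta x (G i).
Proof. exact: (big_morph _ (betaD x) (beta0 x)). Qed.
Let beta_inv x y z : beta (mu x y) z = - beta y (mu x z).
Proof.
rewrite /beta !sgM; have -> : lbr (sg x) (sg y) = - lbr (sg y) (sg x) by rewrite /lbr opprB.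
by rewrite comp_lfunNl linearN /= ltrace_lbr.
Qed.
Let betaM m y : m \in M -> beta y m = 0.
Proof. by move=> mM; rewrite /beta (sg0 mM) comp_lfun0r linear0. Qed.

(** The radical of the trace form is an ideal containing [M]. If it were [L], Cartan's criterion
    would make [L] act as 0. *)
Let beta_rad x : (exists y, sg y != 0) -> (forall y, beta x y = 0) -> x \in M.
Proof.
move=> [y0 sgy0]; pose P x := forall y, beta x y = 0.
have [||R RP] := @vspace_of_pred _ L P.
- by move=> y; rewrite betaC beta0.
- by move=> k u w uP wP y; rewrite betaC betaD betaZ !(betaC y) uP wP mulr0 addr0.
have idR : ideal mu R.
  have LR : forall z w, w \in R -> mu z w \in R.
    by move=> z w /RP wR; apply/RP => y; rewrite beta_inv wR oppr0.
  rewrite /ideal /ideal_of subvf /=; apply/andP; split; apply/prodvsP => z w; first by move=> _;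
      apply: LR.
  move=> /RP zR _; apply/RP => y; rewrite /beta.
  have -> : sg (mu z w) = - sg (mu w z) by rewrite !sgM /lbr opprB.
  by rewrite comp_lfunNl linearN /= -/(beta _ _) (RP (mu w z)).1 ?oppr0 //; apply: LR; apply/RP.
have [|RM|RL] := maxM idR.
- by apply/subvP => m mM; apply/RP => y; rewrite betaC betaM.
- by move=> xP; rewrite -RM; apply/RP.
case/eqP: sgy0; apply: (@cartan_irreducible _ _ sgM char0 sg_irr {:L}%VS M) => //;
    rewrite ?memvf //.
- by move=> *; rewrite memvf.
- by move=> z w _ _; have /RP/(_ w) : z \in R by rewrite RL memvf.
Qed.

(** The map taking x to [rho x v] is a cocycle with values in [U], to be written as the coboundary
    of an element of [U]. The Casimir operator of a complement of [M] is invertible on [U], so Cas u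
    = Cas v has a solution [u] in [U]. Then Cas kills rho x (v - u), which lies in [U] and hence is
    0. *)
Lemma casimir_irreducible : exists2 u, u \in U & forall x, rho x u = rho x v.
Proof.
have [nz|z] := classic (exists y, sg y != 0); last first.
  (* When [L] acts as 0 on [U], both L^2 and [M] kill [v], and L = L^2 + M. *)
  exists 0 => [|x]; first exact: mem0v.
  rewrite linear0.
  have sgz y u : u \in U -> rho y u = 0.
    move=> uU; have : sg y = 0 by apply/eqP; apply: contraT => ny; case: z; exists y.
    move/lfunP/(_ (Subvs uU))/(congr1 vsval); rewrite sub_repE //= => ->.
    by rewrite zero_lfunE linear0.
  have /memv_addP[y yL [m mM ->]] : x \in (prodvs mu {:L} {:L} + M)%VS by apply: (subvP perfM);
      rewrite memvf.
  rewrite linearD add_lfunE (Mv0 mM) addr0.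
  have [r [_ ->]] := prodvs_sum yL.
  rewrite linear_sum sum_lfunE big1 // => p _ /=.
  by rewrite rhoM lbrE !(sgz _ _ (Uv _)) subrr.
pose C := (M^C)%VS; pose r := \dim C; pose e (i : 'I_r) := (vbasis C)`_i.
pose B := \matrix_(i < r, j < r) beta (e i) (e j).
have decomp z : exists c : 'I_r -> F, z - \sum_i c i *: e i \in M.
  have /memv_addP[m mM [c cC ->]] : z \in (M + C)%VS by rewrite addv_complf memvf.
  by exists (fun i => coord (vbasis C) i c); rewrite {1}(coord_vbasis cC) addrK.
have perp w : (forall j, beta w (e j) = 0) -> forall y, beta w y = 0.
  move=> we y; have [d] := decomp y; set m := y - _ => mM.
  have -> : y = m + \sum_i d i *: e i by rewrite subrK.
  rewrite (betaD w) (betaM w mM) add0r (beta_sum w) big1 // => i _.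
  by rewrite betaZ we mulr0.
have unitB : B \in unitmx.
  rewrite -row_free_unit; apply: inj_row_free => c cB.
  pose x := \sum_i c 0 i *: e i.
  have xe j : beta x (e j) = 0.
    transitivity ((c *m B) 0 j); last by rewrite cB mxE.
    rewrite betaC beta_sum mxE; by apply: eq_bigr => i _; rewrite betaZ mxE betaC.
  have xM : x \in M.
    by apply: beta_rad nz _; apply: perp.
  have x0 : x = 0.
    apply/eqP; rewrite -memv0 -(capv_compl M) memv_cap xM rpred_sum // => i _.
    by rewrite rpredZ // vbasis_mem // mem_nth // size_tuple.
  have /freeP frC := basis_free (vbasisP C).
  by apply/rowP => i; rewrite mxE; apply: (frC (fun i => c 0 i)).
have [e' bee'] : exists e' : 'I_r -> L, forall i k, beta (e i) (e' k) = (i == k)%:R.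
  exists (fun i => \sum_j (invmx B) j i *: e j) => i k.
  transitivity ((B *m invmx B) i k); last by rewrite mulmxV // mxE.
  by rewrite beta_sum mxE; apply: eq_bigr => j _; rewrite betaZ mxE mulrC.
have exp1 z : z - \sum_j beta z (e' j) *: e j \in M.
  have [c] := decomp z; set m := z - \sum_i c i *: e i => mM.
  have zE : z = m + \sum_i c i *: e i by rewrite subrK.
  suff cE j : beta z (e' j) = c j by under eq_bigr => j _ do rewrite cE.
  rewrite betaC zE betaD betaM // add0r beta_sum (bigD1 j) //= big1 => [|i ij].
    by rewrite betaZ betaC bee' eqxx mulr1 addr0.
  by rewrite betaZ betaC bee' (negbTE ij) mulr0.
have exp2 z : z - \sum_j beta (e j) z *: e' j \in M.
  set w := z - _; have ew k : beta (e k) w = 0.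
    rewrite /w betaD -scaleN1r betaZ mulN1r beta_sum (bigD1 k) //= big1 => [|i ik].
      by rewrite betaZ bee' eqxx mulr1 addr0 subrr.
    by rewrite betaZ bee' eq_sym (negbTE ik) mulr0.
  by apply: beta_rad => //; apply: perp => k; rewrite betaC.
pose Cas : 'End(V) := \sum_i (rho (e i) \o rho (e' i))%VF.
have CasE w : Cas w = \sum_i rho (e i) (rho (e' i) w).
  by rewrite sum_lfunE; apply: eq_bigr => i _; rewrite comp_lfunE.
have rhoMod z y w : z - y \in M -> (forall m, m \in M -> rho m w = 0) -> rho z w = rho y w.
  by move=> zy Mw; rewrite -(subrK y z) linearD add_lfunE Mw // add0r.
(* By invariance of [beta], the coefficients of [mu x (e i)] and of [mu x (e' i)] in the dual bases
   cancel; the errors lie in [M], which kills the vectors involved. *)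
have Cas_comm x w : (forall y, rho y w \in U) -> (forall m, m \in M -> rho m w = 0) ->
    Cas (rho x w) = rho x (Cas w).
  move=> Uw Mw; apply/esym/eqP; rewrite -subr_eq0 !CasE linear_sum -sumrB /=.
  have brk i : rho x (rho (e i) (rho (e' i) w)) - rho (e i) (rho (e' i) (rho x w)) =
      rho (mu x (e i)) (rho (e' i) w) + rho (e i) (rho (mu x (e' i)) w).
    by rewrite !rhoM !lbrE linearB /= addrA subrK.
  under eq_bigr => i _ do rewrite brk.
  rewrite big_split /=.
  have -> : \sum_i rho (mu x (e i)) (rho (e' i) w) =
      \sum_i \sum_j beta (mu x (e i)) (e' j) *: rho (e j) (rho (e' i) w).
    apply: eq_bigr => i _; rewrite (rhoMod _ _ _ (exp1 (mu x (e i)))); last by move=> m mM;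
        apply: M0.
    by rewrite linear_sum sum_lfunE; apply: eq_bigr => j _; rewrite linearZ scale_lfunE.
  have -> : \sum_i rho (e i) (rho (mu x (e' i)) w) =
      \sum_i \sum_j beta (e i) (mu x (e' j)) *: rho (e j) (rho (e' i) w).
    rewrite exchange_big; apply: eq_bigr => i _; rewrite (rhoMod _ _ _ (exp2 (mu x (e' i)))) //.
    rewrite linear_sum sum_lfunE linear_sum; apply: eq_bigr => j _.
    by rewrite linearZ scale_lfunE linearZ.
  rewrite -big_split big1 //= => i _; rewrite -big_split big1 //= => j _.
  by rewrite beta_inv -scalerDl addNr scale0r.
have CasU w : (forall y, rho y w \in U) -> Cas w \in U.
  by move=> Uw; rewrite CasE rpred_sum // => i _; apply/invU/Uw.
have invK : stable_rep rho (U :&: lker Cas).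
  move=> x u; rewrite !memv_cap !memv_ker => /andP[uU /eqP Cu].
  by rewrite invU //= Cas_comm ?Cu ?linear0 // => *; [apply: invU | apply: M0].
have [K0|KU] := irrU invK (capvSl _ _); last first.
  have [y0 sgy0] := nz; case/negP: sgy0.
  (* If Cas vanishes on [U], its trace there is 0, yet it is the sum of the [r] numbers beta (e i)
     (e' i) = 1. Then M = L, which acts as 0. *)
  suff r0 : r = 0%N.
    apply/eqP/sg0; have := addv_complf M; rewrite -/C.
    have -> : C = 0%VS by apply/eqP; rewrite -dimv_eq0 -/r r0.
    by rewrite addv0 => ->; apply: memvf.
  have sC : \sum_i (sg (e i) \o sg (e' i))%VF = 0.
    apply/lfunP => a; apply: subvs_inj; rewrite zero_lfunE linear0 sum_lfunE linear_sum /=.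
    have : vsval a \in (U :&: lker Cas)%VS by rewrite KU subvsP.
    rewrite memv_cap memv_ker => /andP[_ /eqP Ca]; rewrite -[RHS]Ca CasE; apply: eq_bigr => i _.
    by rewrite comp_lfunE !sub_repE.
  have : \sum_i beta (e i) (e' i) = 0.
    by rewrite -[RHS](linear0 (@ltrace F (subvs_of U))) -sC linear_sum.
  under eq_bigr => i _ do rewrite bee' eqxx.
  rewrite sumr_const card_ord => /eqP; move: char0 => /pcharf0P ->; exact/eqP.
have dimCU : (Cas @: U = U)%VS.
  apply/eqP; rewrite eqEdim limg_dim_eq // leqnn andbT.
  apply/subvP => _ /memv_imgP[u uU ->]; apply: CasU => y; exact: invU.
have : Cas v \in (Cas @: U)%VS by rewrite dimCU CasU.
case/memv_imgP => u uU Cvu; exists u => // x.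
have Uw y : rho y (v - u) \in U by rewrite linearB rpredB ?Uv ?invU.
have Mw m : m \in M -> rho m (v - u) = 0 by move=> mM; rewrite linearB /= Mv0 // M0 // subrr.
apply/esym/eqP; rewrite -subr_eq0 -linearB -memv0 -K0 memv_cap memv_ker Uw /=.
by rewrite Cas_comm // [Cas _]linearB /= Cvu subrr linear0.
Qed.

End IrrCase.

(** Solve modulo a minimal submodule [Q] by induction and lift the solution to [u']; then [L] moves
    [v - u'] into [Q], where the irreducible case applies. Taking [v] in an ambient module makes the
    cocycle identity automatic. *)
Lemma first_cohomology (V : vectType F) (rho : {linear L -> 'End(V)}) (U : {vspace V}) (v : V) :
  is_rep rho -> stable_rep rho U -> (forall m u, m \in M -> u \in U -> rho m u = 0) ->
  (forall m, m \in M -> rho m v = 0) -> (forall x, rho x v \in U) ->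
  exists2 u, u \in U & forall x, rho x u = rho x v.
Proof.
have [k] := ubnP (\dim U); elim: k V rho U v => // k IHk V rho U v lek rhoM invU M0 Mv0 Uv.
have [U0|U0] := eqVneq U 0%VS.
  exists 0; rewrite ?mem0v // => x; rewrite linear0.
  by have := Uv x; rewrite U0 memv0 => /eqP ->.
pose P (W : {vspace V}) := [/\ W != 0%VS, stable_rep rho W & (W <= U)%VS].
have [Q [[Q0 invQ QU] _ Qmin]] := @ex_min_vspace _ _ P U (And3 U0 invU (subvv _)).
have irrQ W : stable_rep rho W -> (W <= Q)%VS -> W = 0%VS \/ W = Q.
  move=> invW WQ; have [->|W0] := eqVneq W 0%VS; [by left | right].
  by apply: Qmin => //; split=> //; apply: subv_trans QU.
pose pi := quot_proj Q.
have [||||||_ /memv_imgP[u' u'U ->] u'P] := IHk _ (quot_rep rho Q) (pi @: U)%VS (pi v).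
- have := limg_ker_dim pi U; rewrite quot_proj_ker (capv_idPr QU) => e.
  have lt : (\dim (pi @: U) < \dim U)%N by rewrite -e -addn1 addnC leq_add2r lt0n dimv_eq0.
  exact: leq_trans lt lek.
- exact: quot_is_rep.
- by move=> x _ /memv_imgP[u uU ->]; rewrite quot_repE // memv_img // invU.
- by move=> m _ mM /memv_imgP[u uU ->]; rewrite quot_repE // M0 // linear0.
- by move=> m mM; rewrite quot_repE // Mv0 // linear0.
- by move=> x; rewrite quot_repE // memv_img.
have [|m mM|x|q qQ qP] := @casimir_irreducible _ rho Q (v - u') rhoM invQ Q0 irrQ.
- by move=> m u mM uQ; rewrite M0 // (subvP QU).
- by rewrite linearB /= Mv0 // M0 // subrr.
- rewrite (memv_quot Q) linearB /= linearB /= subr_eq0.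
  by rewrite -!(quot_repE invQ) u'P.
exists (u' + q); first by rewrite rpredD // (subvP QU).
by move=> x; rewrite linearD /= qP linearB /= subrKC.
Qed.

End Casimir.
End Rep.

(** * Ideals of Leibniz algebras *)

Section Ideals.
Variables (F : fieldType) (L : vectType F) (mu : {bilinear L -> L -> L}).
Implicit Types A B I J M N S U W : {vspace L}.

Lemma idealP I : reflect (forall x y, y \in I -> mu x y \in I /\ mu y x \in I) (ideal mu I).
Proof.
apply: (iffP and3P) => [[_ /prodvsP LI /prodvsP IL] x y yI | H].
  by split; [apply: LI | apply: IL]; rewrite ?memvf.
by rewrite subvf; split=> //; apply/prodvsP => x y; [move=> _ /(H x)[] | move=> /(H y)[]].
Qed.

Lemma prodvsS U U' W W' : (U <= U')%VS -> (W <= W')%VS -> (prodvs mu U W <= prodvs mu U' W')%VS.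
Proof.
by move=> /subvP UU /subvP WW; apply/prodvsP => u w uU wW; apply: memv_prodvs; auto.
Qed.

Lemma idealD I J : ideal mu I -> ideal mu J -> ideal mu (I + J).
Proof.
move=> /idealP idI /idealP idJ; apply/idealP => x _ /memv_addP[i iI [j jJ ->]].
by rewrite linearDr linearDl; have [? ?] := idI x i iI; have [? ?] := idJ x j jJ; split;
    apply: memv_add.
Qed.

Lemma ideal_over_square I : (prodvs mu {:L} {:L} <= I)%VS -> ideal mu I.
Proof.
by move=> /subvP L2; apply/idealP => x y _; split; apply/L2/memv_prodvs; apply: memvf.
Qed.

Hypothesis muL : leibniz mu.

Lemma leibniz_l x y z : mu (mu x y) z = mu x (mu y z) - mu y (mu x z).
Proof. by rewrite muL addrK. Qed.

Lemma ideal_square I : ideal mu I -> ideal mu (prodvs mu I I).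
Proof.
move=> /idealP idI; apply/idealP => x _ /prodvs_sum[r [rP ->]].
rewrite linear_sumr linear_sumlz !big_seq; split; apply: rpred_sum => p /rP[p1 p2].
all: have [? ?] := idI x _ p1; have [? ?] := idI x _ p2.
  by rewrite muL rpredD // memv_prodvs.
by rewrite leibniz_l rpredB // memv_prodvs // (idI _ _ _).1.
Qed.

Lemma ideal_subalgebra I : ideal mu I -> subalgebra mu I.
Proof. by move=> /idealP idI; apply/prodvsP => x y _ /(idI x)[]. Qed.

Lemma prodvs0r U : prodvs mu U 0 = 0%VS.
Proof. by apply/eqP; rewrite -subv0; apply/prodvsP => u w _; rewrite !memv0 => /eqP ->;
    rewrite linear0r. Qed.

(** The series multiplies on the left only; the Leibniz identity trades a product in the left factor
    for two left multiplications. The successor appears because [lcs mu A k] is A^(k+1). *)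
Lemma lcs_mul A i j x y : x \in lcs mu A i -> y \in lcs mu A j -> mu x y \in lcs mu A (i + j).+1.
Proof.
elim: i j x y => [|i IHi] j x y; first by move=> xA yj; rewrite add0n; apply: memv_prodvs.
case/prodvs_sum => r [rP ->] yj; rewrite linear_sumlz big_seq; apply: rpred_sum => p /rP[p1 p2].
rewrite leibniz_l rpredB //.
  by rewrite addSn; apply: memv_prodvs => //; apply: IHi.
by rewrite addSnnS; apply: IHi => //; apply: memv_prodvs.
Qed.

Lemma square_eq_nilp A : nilpotent mu A -> prodvs mu A A = A -> A = 0%VS.
Proof.
move=> [k k0] AA; rewrite -k0; elim: k {k0} => // k IHk.
by rewrite /lcs iterS -/(lcs _ _ _) -IHk AA.
Qed.

(* Unlike maximal ideals, this form of uniqueness passes to quotients directly. *)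
Definition top_ideal M :=
  [/\ ideal mu M, M != fullv & forall I, ideal mu I -> I = {:L}%VS \/ (I <= M)%VS].

Lemma top_idealP M : (fullv != 0%VS :> {vspace L}) ->
  maximal_ideal mu M -> (forall M', maximal_ideal mu M' -> M' = M) -> top_ideal M.
Proof.
move=> L0 [idM M1 maxM] uniqM; split=> // I idI.
have [->|I1] := eqVneq I {:L}%VS; [by left | right].
pose P W := ideal mu W /\ W != fullv.
have [J [[idJ J1] IJ Jmax]] := @ex_max_vspace _ _ P I (conj idI I1).
suff <- : J = M by [].
apply: uniqM; split=> // W idW JW; have [->|W1] := eqVneq W {:L}%VS; [by right | left].
exact: Jmax.
Qed.

Lemma top_ideal_square M : top_ideal M -> (M <= prodvs mu {:L} {:L})%VS.
Proof.
move=> [idM M1 topM]; set L2 := prodvs mu _ _.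
have [->|L2M] := topM L2 (ideal_over_square (subvv _)); first exact: subvf.
apply/subvP => m mM; apply: contraT => mL2.
(* A hyperplane containing L^2 and missing [m]: it is an ideal, and together with [m] it spans [L],
   so [M] cannot contain it. *)
pose H := (L2 + (L2 + <[m]>)^C)%VS.
have [HL|HM] := topM H (ideal_over_square (addvSl _ _)).
  have : m \in H by rewrite HL memvf.
  case/memv_addP => a aL2 [c cC e].
  have c0 : c = 0.
    apply/eqP; rewrite -memv0 -(capv_compl (L2 + <[m]>)) memv_cap cC andbT.
    have -> : c = - a + m by rewrite e addKr.
    by rewrite memv_add ?rpredN ?memv_line.
  by case/negP: mL2; rewrite e c0 addr0.
case/negP: M1; rewrite eqEsubv subvf -(addv_complf (L2 + <[m]>)%VS) !subv_add L2M -memvE mM /=.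
by apply: subv_trans HM; apply: addvSr.
Qed.

(** The j in [J] with jL = 0 form an ideal, hence 0 or [J]. It contains every jx + xj, since left
    multiplications by jx and by xj are opposite. *)
Lemma minimal_ideal_cases J : ideal mu J ->
  (forall I, ideal mu I -> (I <= J)%VS -> I = 0%VS \/ I = J) ->
  (forall x j, j \in J -> mu j x = - mu x j) \/ (forall x j, j \in J -> mu j x = 0).
Proof.
move=> /idealP idJ minJ.
have [||Z ZP] := @vspace_of_pred _ L (fun j => j \in J /\ forall x, mu j x = 0).
- by split=> [|x]; rewrite ?mem0v ?linear0l.
- move=> k x y [xJ x0] [yJ y0]; split=> [|z]; first by rewrite rpredD ?rpredZ.
  by rewrite linearPl x0 y0 scaler0 addr0.
have [||Z0|ZJ] := minJ Z.
- apply/idealP => x z /ZP[zJ z0]; have [? ?] := idJ x z zJ.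
  by split; apply/ZP; split=> // y; rewrite ?z0 ?linear0l // leibniz_l !z0 linear0r subr0.
- by apply/subvP => z /ZP[].
- left=> x j jJ; apply/eqP; rewrite -addr_eq0 addrC -memv0 -Z0; apply/ZP.
  have [? ?] := idJ x j jJ; split=> [|y]; first by rewrite rpredD.
  by rewrite linearDl /= !leibniz_l addrA subrK subrr.
by right=> x j; rewrite -ZJ => /ZP[].
Qed.

Definition lmul (x : L) : 'End(L) := linfun (mu x).
Lemma lmul_linear : linear lmul.
Proof.
by move=> k x y; apply/lfunP => z; rewrite add_lfunE scale_lfunE !lfunE /= linearPl.
Qed.
HB.instance Definition _ := GRing.isLinear.Build F L _ _ lmul lmul_linear.

Lemma lmulE x y : lmul x y = mu x y. Proof. by rewrite lfunE. Qed.

Lemma lmul_is_rep : is_rep mu lmul.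
Proof. by move=> x y; apply/lfunP => z; rewrite lbrE !lmulE leibniz_l. Qed.

End Ideals.

Section QuotientAlgebra.
Variables (F : fieldType) (L : vectType F) (mu : {bilinear L -> L -> L}) (J : {vspace L}).
Hypotheses (muL : leibniz mu) (idJ : ideal mu J).
Local Notation pi := (quot_proj J).
Local Notation qmu := (quot_mul mu J : {bilinear quotvs J -> quotvs J -> quotvs J}).
Implicit Types U W I M : {vspace L}.

Lemma quot_leibniz : leibniz qmu.
Proof.
move=> a b c; rewrite -(quot_reprK a) -(quot_reprK b) -(quot_reprK c) /=.
by rewrite -!quot_projM // muL linearD.
Qed.

Lemma quot_surj (a : quotvs J) : exists x, a = pi x.
Proof. by exists (quot_repr a); rewrite quot_reprK. Qed.

Lemma quot_img_full : (pi @: {:L})%VS = fullv. Proof. exact: quot_proj_surj. Qed.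

Lemma quot_img_prodvs U W : (pi @: prodvs mu U W)%VS = prodvs qmu (pi @: U) (pi @: W).
Proof.
apply/eqP; rewrite eqEsubv; apply/andP; split.
  apply/subvP => _ /memv_imgP[z /prodvs_sum[r [rP ->]] ->].
  rewrite linear_sum big_seq rpred_sum // => p /rP[p1 p2] /=.
  by rewrite quot_projM // (memv_prodvs qmu) // memv_img.
apply/prodvsP => _ _ /memv_imgP[u uU ->] /memv_imgP[w wW ->] /=.
by rewrite -quot_projM // memv_img // memv_prodvs.
Qed.

Lemma quot_img_sub U W : (J <= W)%VS -> (pi @: U <= pi @: W)%VS = (U <= W)%VS.
Proof.
move=> JW; apply/idP/idP => [/subvP UW | UW]; last exact: limgS.
apply/subvP => u uU; have /memv_imgP[w wW e] := UW _ (memv_img pi uU).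
have dJ : u - w \in J by rewrite memv_quot linearB /= e subrr.
by rewrite -(subrK w u) rpredD // (subvP JW).
Qed.

Lemma quot_preimK (V : {vspace quotvs J}) : (pi @: (pi @^-1: V))%VS = V.
Proof. by rewrite lpreimK // quot_proj_surj subvf. Qed.

Lemma quot_ideal_img I : ideal mu I -> ideal qmu (pi @: I).
Proof.
move=> /idealP idI; apply/idealP => a _ /memv_imgP[y yI ->]; have [x ->] := quot_surj a.
by have [? ?] := idI x y yI; rewrite /= -!quot_projM //; split; apply: memv_img.
Qed.

Lemma quot_ideal_preim (V : {vspace quotvs J}) : ideal qmu V -> ideal mu (pi @^-1: V).
Proof.
move=> /idealP idV; apply/idealP => x y; rewrite -!memv_preim !quot_projM //.
exact: idV.
Qed.

Lemma quot_img_lcs M k : (pi @: lcs mu M k)%VS = lcs qmu (pi @: M) k.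
Proof. by elim: k => //= k IHk; rewrite quot_img_prodvs IHk. Qed.

Lemma quot_img_eq0 U : ((pi @: U)%VS == 0%VS) = (U <= J)%VS.
Proof. by rewrite -lkerE quot_proj_ker. Qed.

Lemma quot_img_eqf U : (J <= U)%VS -> ((pi @: U)%VS == fullv) = (U == fullv).
Proof.
move=> JU; rewrite -quot_img_full eqEsubv !quot_img_sub ?subvf // eqEsubv.
by rewrite !subvf.
Qed.

End QuotientAlgebra.

Lemma top_ideal_quot (F : fieldType) (L : vectType F) (mu : {bilinear L -> L -> L}) (J M :
    {vspace L}) :
  ideal mu J -> (J <= M)%VS -> top_ideal mu M ->
  top_ideal (quot_mul mu J : {bilinear quotvs J -> quotvs J -> quotvs J}) (quot_proj J @: M).
Proof.
move=> idJ JM [idM M1 topM]; split.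
- exact: quot_ideal_img.
- by rewrite quot_img_eqf.
move=> V idV; rewrite -(quot_preimK V).
have [->|] := topM _ (quot_ideal_preim idJ idV); [left | right].
  exact: quot_img_full.
exact: limgS.
Qed.

(* A nonabelian minimal ideal is a direct factor: its Killing form is
   nondegenerate, so every left multiplication acts on it as an inner one. *)
Lemma nonabelian_minimal_ideal (F : fieldType) (L : vectType F) (mu : {bilinear L -> L -> L})
    (J : {vspace L}) :
  [pchar F] =i pred0 -> leibniz mu -> ideal mu J -> prodvs mu J J != 0%VS ->
  (forall I, ideal mu I -> (I <= J)%VS -> I = 0%VS \/ I = J) ->
  exists C, [/\ ideal mu C, C != fullv & (J + C = {:L})%VS].
Proof.
move=> char0 muL idJ JJ0 minJ; have /idealP idJP := idJ.
have JJ : prodvs mu J J = J.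
  by have [|//] := minJ _ (ideal_square muL idJ) (ideal_subalgebra idJ) => e; rewrite e eqxx in JJ0.
have anti : forall x j, j \in J -> mu j x = - mu x j.
  have [//|z] := minimal_ideal_cases muL idJ minJ.
  by case/eqP: JJ0; apply/eqP; rewrite -subv0; apply/prodvsP => x y xJ _; rewrite z // mem0v.
(* Inside [J] right multiplication is minus left multiplication, so left stability suffices. *)
have leftideal W : (W <= J)%VS -> (forall x w, w \in W -> mu x w \in W) -> W = 0%VS \/ W = J.
  move=> WJ LW; apply: minJ => //; apply/idealP => x w wW; split; first exact: LW.
  by rewrite anti ?rpredN ?LW // (subvP WJ).
have J0 : J != 0%VS by apply: contraNneq JJ0 => e; rewrite e prodvs0r.
have invJ : stable_rep (lmul mu) J by move=> x u uJ; rewrite lmulE; have [] := idJP x u uJ.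
pose rho : {linear L -> 'End(subvs_of J)} := sub_rep (lmul mu) J.
have rhoM : is_rep mu rho by apply: sub_is_rep => //; apply: lmul_is_rep.
have rhoE x a : vsval (rho x a) = mu x (vsval a) by rewrite sub_repE // lmulE.
have irr : irreducible_rep rho.
  apply: sub_rep_irreducible => // W invW WJ; apply: leftideal => // x w wW.
  by rewrite -lmulE; apply: invW.
pose beta x y := ltrace (rho x \o rho y)%VF.
have beta_inv x y z : beta (mu x y) z = - beta y (mu x z).
  rewrite /beta !rhoM; have -> : lbr (rho x) (rho y) = - lbr (rho y) (rho x) by rewrite /lbr opprB.
  by rewrite comp_lfunNl linearN /= ltrace_lbr.
have betaC x y : beta x y = beta y x by apply: ltraceC.
have beta_linr x : linear (beta x : L -> F^o).
  by move=> k y z; rewrite /beta linearP comp_lfunDr -comp_lfunZr linearP.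
have beta_rad x : x \in J -> (forall y, y \in J -> beta x y = 0) -> x = 0.
  move=> xJ x0.
  have [||R RP] := @vspace_of_pred _ L (fun j => j \in J /\ forall y, y \in J -> beta j y = 0).
  - by split=> [|y yJ]; rewrite ?mem0v // /beta linear0 comp_lfun0l linear0.
  - move=> k u w [uJ u0] [wJ w0]; split=> [|y yJ]; first by rewrite rpredD ?rpredZ.
    by rewrite betaC beta_linr !(betaC y) u0 // w0 // scaler0 addr0.
  have [||R0|RJ] := leftideal R.
  - by apply/subvP => z /RP[].
  - move=> z w /RP[wJ w0]; apply/RP; split=> [|y yJ]; first by case: (idJP z w wJ).
    by rewrite beta_inv w0 ?oppr0 //; case: (idJP z y yJ).
  - by apply/eqP; rewrite -memv0 -R0; apply/RP.
  have rho0 : forall y, y \in J -> rho y = 0.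
    apply: (@cartan_irreducible _ _ _ _ _ rhoM char0 irr J 0%VS).
    - by move=> u y yJ; case: (idJP u y yJ).
    - by rewrite addv0 JJ.
    - by move=> y; rewrite memv0 => /eqP ->; rewrite linear0.
    - by move=> u w uJ wJ; have /RP[_ u0] : u \in R; [rewrite RJ | apply: u0].
  case/eqP: JJ0; apply/eqP; rewrite -subv0; apply/prodvsP => u w uJ wJ.
  have := rhoE u (Subvs wJ); rewrite rho0 // zero_lfunE linear0 /= => <-.
  exact: mem0v.
pose b (i : 'I_(\dim J)) := (vbasis J)`_i.
pose phi_fun x : 'rV[F]_(\dim J) := \row_i beta x (b i).
have phi_lin : linear phi_fun.
  move=> k x y; apply/rowP => i; rewrite !mxE betaC beta_linr.
  by rewrite ![beta (b i) _]betaC.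
pose phiL := GRing.isLinear.Build F L 'rV[F]_(\dim J) _ phi_fun phi_lin.
pose phiF : {linear L -> 'rV[F]_(\dim J)} := HB.pack phi_fun phiL.
pose phi := linfun phiF.
have phiE x i : phi x 0 i = beta x (b i) by rewrite lfunE /= mxE.
have phi_basis x : phi x = 0 -> forall y, y \in J -> beta x y = 0.
  move=> x0 y yJ; rewrite (coord_vbasis yJ).
  rewrite (big_morph (beta x) (id1 := 0) (op1 := +%R)); last 2 first.
  - by move=> u w; have := beta_linr x 1 u w; rewrite !scale1r.
  - by rewrite /beta linear0 comp_lfun0r linear0.
  rewrite big1 // => i _; have := beta_linr x (coord (vbasis J) i y) (b i) 0.
  rewrite addr0 => ->; rewrite -phiE x0 mxE scaler0 add0r.
  by rewrite /beta linear0 comp_lfun0r linear0.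
have phiJ : (phi @: J)%VS = fullv.
  apply/eqP; rewrite eqEdim subvf dimvf limg_dim_eq.
    by rewrite /dim /= mul1n.
  apply/eqP; rewrite -subv0; apply/subvP => x; rewrite memv_cap memv_ker memv0.
  by case/andP => xJ /eqP/phi_basis x0; apply/eqP/beta_rad.
have [||C CP] := @vspace_of_pred _ L (fun d => forall a, a \in J -> mu d a = 0).
- by move=> a _; rewrite linear0l.
- by move=> k x y x0 y0 a aJ; rewrite linearPl x0 // y0 // scaler0 addr0.
exists C; split.
- apply/idealP => x d /CP d0; have dx a : a \in J -> mu d (mu x a) = 0 /\ mu x (mu d a) = 0.
    by move=> aJ; rewrite !d0 ?linear0r //; case: (idJP x a aJ).
  by split; apply/CP => a aJ; have [e1 e2] := dx a aJ; rewrite leibniz_l // e1 e2 subrr.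
- apply: contraNneq JJ0 => CL; rewrite -subv0; apply/prodvsP => u w uJ wJ.
  by have /CP u0 : u \in C; [rewrite CL memvf | rewrite u0 // mem0v].
apply/eqP; rewrite eqEsubv subvf; apply/subvP => x _.
have : phi x \in (phi @: J)%VS by rewrite phiJ memvf.
case/memv_imgP => a aJ e; rewrite -(subrK a x) addrC memv_add //.
(* As x - a is orthogonal to [J], invariance gives beta ((x - a)c) y = beta (x - a) (cy) = 0 for c
   and y in [J]; nondegeneracy then yields (x - a)c = 0. *)
have d0 : phi (x - a) = 0 by rewrite linearB /= e subrr.
apply/CP => c cJ; apply: beta_rad; first by case: (idJP (x - a) c cJ).
move=> y yJ; have cy : mu c y \in J by case: (idJP c y yJ).
have := phi_basis _ d0 _ cy.
rewrite /beta !rhoM => <-.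
by rewrite ltrace_lbr.
Qed.

Lemma top_ideal_nilpotent (F : fieldType) (L : vectType F) (mu : {bilinear L -> L -> L}) (M :
    {vspace L}) :
  [pchar F] =i pred0 -> leibniz mu -> top_ideal mu M -> nilpotent mu M.
Proof.
move=> char0; have [n] := ubnP (\dim {:L}); elim: n L mu M => // n IHn L mu M ltn muL topM.
have [M0|M0] := eqVneq M 0%VS; first by exists 0%N.
have [idM M1 top] := topM; have /idealP idMP := idM.
pose P J := [/\ J != 0%VS, ideal mu J & (J <= M)%VS].
have [J [[J0 idJ JM] _ Jmin]] := @ex_min_vspace _ _ P M (And3 M0 idM (subvv _)).
have /idealP idJP := idJ.
have minJ I : ideal mu I -> (I <= J)%VS -> I = 0%VS \/ I = J.
  move=> idI IJ; have [->|I0] := eqVneq I 0%VS; [by left | right].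
  by apply: Jmin => //; split=> //; apply: subv_trans JM.
have [k kJ] : exists k, (lcs mu M k <= J)%VS.
  have [|||k k0] := IHn (quotvs J) (quot_mul mu J) (quot_proj J @: M)%VS.
  - have := limg_ker_dim (quot_proj J) {:L}; rewrite quot_proj_ker capfv quot_img_full => e.
    have lt : (\dim {:quotvs J} < \dim {:L})%N by rewrite -e -addn1 addnC leq_add2r lt0n dimv_eq0.
    exact: leq_trans lt ltn.
  - exact: quot_leibniz.
  - exact: top_ideal_quot.
  by exists k; rewrite -quot_img_eq0 quot_img_lcs // k0.
suff MJ : prodvs mu M J = 0%VS.
  by exists k.+1; apply/eqP; rewrite -subv0 -MJ; apply: prodvsS.
have casesJ := minimal_ideal_cases muL idJ minJ.
have [JJ0|JJ] := eqVneq (prodvs mu J J) 0%VS; last first.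
  have [C [idC C1 JC]] := nonabelian_minimal_ideal char0 muL idJ JJ minJ.
  have [CL|CM] := top C idC; first by rewrite CL eqxx in C1.
  by case/negP: M1; rewrite eqEsubv subvf -JC subv_add JM.
have leftideal W : (W <= J)%VS -> (forall x w, w \in W -> mu x w \in W) -> W = 0%VS \/ W = J.
  move=> WJ LW; apply: minJ => //; apply/idealP => x w wW; split; first exact: LW.
  have wJ := subvP WJ w wW; have [anti|zero] := casesJ; first by rewrite anti ?rpredN ?LW.
  by rewrite zero ?mem0v.
have invJ : stable_rep (lmul mu) J by move=> x u uJ; rewrite lmulE; have [] := idJP x u uJ.
pose rho : {linear L -> 'End(subvs_of J)} := sub_rep (lmul mu) J.
have rhoM : is_rep mu rho by apply: sub_is_rep => //; apply: lmul_is_rep.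
have rhoE x a : vsval (rho x a) = mu x (vsval a) by rewrite sub_repE // lmulE.
have irr : irreducible_rep rho.
  apply: sub_rep_irreducible => // W invW WJ; apply: leftideal => // x w wW.
  by rewrite -lmulE; apply: invW.
have rho0 : forall x, x \in M -> rho x = 0.
  apply: (@lcs_irreducible _ _ _ _ _ rhoM char0 irr M k) => //.
  - by move=> x y yM; case: (idMP x y yM).
  - exact: top_ideal_square.
  move=> x /(subvP kJ) xJ; apply/lfunP => a; apply: subvs_inj.
  rewrite rhoE zero_lfunE linear0; apply/eqP; rewrite -memv0 -JJ0.
  by apply: memv_prodvs => //; apply: subvsP.
apply/eqP; rewrite -subv0; apply/prodvsP => m j mM jJ.
by have := rhoE m (Subvs jJ); rewrite rho0 // zero_lfunE linear0 /= => <-; apply: mem0v.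
Qed.

(** * Levi complements *)

Section AdjointOperators.
Variables (F : fieldType) (V : vectType F).

Lemma lbr_linear (f : 'End(V)) : linear (lbr f).
Proof. by move=> k g h; rewrite linearPr. Qed.
HB.instance Definition _ f := GRing.isLinear.Build F _ _ _ (lbr f) (lbr_linear f).

Definition adlfun (f : 'End(V)) : 'End('End(V)) := linfun (lbr f).
Lemma adlfun_linear : linear adlfun.
Proof.
by move=> k f g; apply/lfunP => h; rewrite add_lfunE scale_lfunE !lfunE /= linearPl.
Qed.
HB.instance Definition _ := GRing.isLinear.Build F _ _ _ adlfun adlfun_linear.

Lemma adlfunE f g : adlfun f g = lbr f g. Proof. by rewrite lfunE. Qed.

Lemma lbr_jacobi (f g h : 'End(V)) : lbr (lbr f g) h = lbr f (lbr g h) - lbr g (lbr f h).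
Proof.
apply/lfunP => v; rewrite add_lfunE opp_lfunE !lbrE !linearB /=.
move: (f (g (h v))) (g (f (h v))) (h (f (g v))) (h (g (f v))) (f (h (g v))) (g (h (f v))).
move=> a b c d e k; rewrite !opprK [- b + k + _]addrC [RHS]addrACA subrKA.
rewrite [- k + d]addrC [- b + k]addrC subrKA.
by rewrite [- c + d]addrC [LHS]addrACA [RHS]addrACA [- b - c]addrC.
Qed.

End AdjointOperators.

Section AbelianExtension.
Variables (F : fieldType) (L : vectType F) (mu : {bilinear L -> L -> L}) (K : {vspace L}).
Hypotheses (char0 : [pchar F] =i pred0) (muL : leibniz mu) (idK : ideal mu K).
Hypotheses (KK : forall a b, a \in K -> b \in K -> mu a b = 0)
  (maxK : forall I, ideal mu I -> (K <= I)%VS -> I = K \/ I = {:L}%VS)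
  (perfK : ({:L} <= prodvs mu {:L} {:L} + K)%VS).

Local Notation lmul := (lmul mu).
Definition adrep (x : L) : 'End('End(L)) := adlfun (lmul x).
Lemma adrep_linear : linear adrep.
Proof.
move=> k x y; apply/lfunP => f; rewrite add_lfunE scale_lfunE /adrep !adlfunE.
rewrite -linearPl; congr (lbr _ f).
exact: lmul_linear.
Qed.
HB.instance Definition _ := GRing.isLinear.Build F L _ _ adrep adrep_linear.

Lemma adrep_lbr x f : adrep x f = lbr (lmul x) f. Proof. exact: adlfunE. Qed.

Lemma adrep_is_rep : is_rep mu adrep.
Proof.
move=> x y; apply/lfunP => f; rewrite lbrE !adrep_lbr.
by rewrite (lmul_is_rep muL) lbr_jacobi.
Qed.

Lemma adrepE x f y : adrep x f y = mu x (f y) - f (mu x y).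
Proof. by rewrite adrep_lbr lbrE !lmulE. Qed.

(* The first Whitehead lemma corrects an arbitrary projection onto [K] by an
   operator from [L / K] to [K]; only modulo left multiplications by [K] do
   such operators form a module killed by [K]. *)
Lemma equivariant_projection : exists phi : 'End(L),
  [/\ forall y, phi y \in K, forall a, a \in K -> phi a = a &
      forall x, exists2 a, a \in K & lbr (lmul x) phi = lmul a].
Proof.
have /idealP idKP := idK.
have LK x a : a \in K -> mu x a \in K by move=> aK; case: (idKP x a aK).
have KL a x : a \in K -> mu a x \in K by move=> aK; case: (idKP x a aK).
pose P : {vspace 'End(L)} := (linfun lmul @: K)%VS.
have PP a : a \in K -> lmul a \in P by move=> aK; rewrite -[lmul a](lfunE lmul) memv_img.
have invP : stable_rep adrep P.
  move=> x _ /memv_imgP[a aK ->]; rewrite (lfunE lmul) adrep_lbr -lmul_is_rep //.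
  exact/PP/LK.
have [||U0 U0P] := @vspace_of_pred _ 'End(L)
    (fun f => (forall y, f y \in K) /\ (forall a, a \in K -> f a = 0)).
- by split=> [y|a _]; rewrite zero_lfunE ?mem0v.
- move=> k f g [fK f0] [gK g0]; split=> [y|a aK]; rewrite add_lfunE scale_lfunE.
    by rewrite rpredD ?rpredZ.
  by rewrite f0 // g0 // scaler0 addr0.
pose phi0 := projv K.
have phi0K y : phi0 y \in K by apply: memv_proj.
have phi0id a : a \in K -> phi0 a = a by apply: projv_id.
have brU0 x (f : 'End(L)) c : (forall y, f y \in K) -> (forall a, a \in K -> f a = c *: a) ->
    adrep x f \in U0.
  move=> fK fc; apply/U0P; split=> [y|a aK]; rewrite adrepE.
    by rewrite rpredB ?LK.
  by rewrite !fc ?LK // linearZr_LR subrr.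
have [|||||_ /memv_imgP[f0 f0U ->] f0P] :=
  @first_cohomology F L mu K char0 maxK perfK (quotvs P) (quot_rep adrep P)
    (quot_proj P @: U0)%VS (quot_proj P phi0).
- by apply: quot_is_rep => //; apply: adrep_is_rep.
- move=> x _ /memv_imgP[f /U0P[fK f0] ->]; rewrite quot_repE // memv_img //.
  by apply: (brU0 x f 0) => // a aK; rewrite f0 ?scale0r.
- move=> m _ mK /memv_imgP[f /U0P[fK f0] ->]; rewrite quot_repE //.
  have -> : adrep m f = 0; last by rewrite linear0.
  by apply/lfunP => y; rewrite adrepE KK // f0 ?KL // subrr zero_lfunE.
- move=> m mK; rewrite quot_repE //; apply/eqP; rewrite -memv_quot.
  (* This is where [P] must be factored out: an element m of [K] moves the projection, but only by a
     left multiplication from [K]. *)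
  have -> : adrep m phi0 = - lmul m; last by rewrite rpredN PP.
  by apply/lfunP => y; rewrite adrepE KK // phi0id ?KL // sub0r opp_lfunE lmulE.
- move=> x; rewrite quot_repE // memv_img //.
  by apply: (brU0 x phi0 1) => // a aK; rewrite scale1r phi0id.
have /U0P[f0K f00] := f0U.
exists (phi0 - f0); split.
- by move=> y; rewrite add_lfunE opp_lfunE rpredB.
- by move=> a aK; rewrite add_lfunE opp_lfunE phi0id // f00 // subr0.
move=> x; have : adrep x (phi0 - f0) \in P.
  by rewrite memv_quot linearB /= linearB /= subr_eq0 -!quot_repE // f0P.
by case/memv_imgP => a aK; rewrite adrep_lbr (lfunE lmul) => ->; exists a.
Qed.

(** The x whose left multiplication commutes with [phi] form a subalgebra [S1]. Since [lmul a, phi]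
    = - lmul a for a in [K], every x is corrected into [S1] by an element of [K]. It may happen that
    [S1] is [L], namely when KL = 0; then the kernel of [phi] is stable under left multiplication
    and serves instead. *)
Lemma proper_supplement : K != 0%VS ->
  exists S, [/\ subalgebra mu S, (S + K = {:L})%VS & S != {:L}%VS].
Proof.
move=> K0; have /idealP idKP := idK.
have [phi [phiK phi_id phi_br]] := equivariant_projection.
have [||S1 S1P] := @vspace_of_pred _ L (fun x => lbr (lmul x) phi = 0).
- by rewrite linear0 linear0l.
- by move=> k x y x0 y0; rewrite linearP linearPl /= x0 y0 scaler0 addr0.
have S1alg : subalgebra mu S1.
  apply/prodvsP => x y /S1P x0 /S1P y0; apply/S1P.
  by rewrite lmul_is_rep //= lbr_jacobi x0 y0 !linear0r subrr.
have S1K : (S1 + K = {:L})%VS.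
  apply/eqP; rewrite eqEsubv subvf; apply/subvP => x _; have [a aK ea] := phi_br x.
  rewrite -(addrK a x) memv_add ?rpredN //; apply/S1P.
  rewrite linearD linearDl /= ea; apply/lfunP => y; rewrite add_lfunE lbrE !lmulE zero_lfunE.
  have ayK : mu a y \in K by case: (idKP y a aK).
  by rewrite (KK aK (phiK y)) (phi_id _ ayK) sub0r subrr.
have [S1L|S1L] := eqVneq S1 {:L}%VS; last by exists S1.
have phi_comm x y : phi (mu x y) = mu x (phi y).
  have /S1P/lfunP/(_ y) : x \in S1 by rewrite S1L memvf.
  by rewrite lbrE !lmulE zero_lfunE => /eqP; rewrite subr_eq0 => /eqP.
exists (lker phi); split.
- apply/prodvsP => x y _; rewrite !memv_ker => /eqP y0.
  by rewrite phi_comm y0 linear0r.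
- apply/eqP; rewrite eqEsubv subvf; apply/subvP => x _.
  by rewrite -(subrK (phi x) x) memv_add // memv_ker linearB /= (phi_id (phi x)) ?subrr.
apply: contraNneq K0 => e; rewrite -subv0; apply/subvP => a aK.
have : a \in lker phi by rewrite e memvf.
by rewrite memv_ker phi_id // memv0.
Qed.

End AbelianExtension.

Section SubAlgebra.
Variables (F : fieldType) (L : vectType F) (mu : {bilinear L -> L -> L}) (A : {vspace L}).

Definition sub_mul (a b : subvs_of A) : subvs_of A := vsproj A (mu (vsval a) (vsval b)).

Lemma sub_mul_bilinear : bilinear_for *:%R *:%R sub_mul.
Proof.
by split=> [b | a] k x y; rewrite /sub_mul linearP; rewrite ?linearPl ?linearPr linearP.
Qed.
HB.instance Definition _ := bilinear_isBilinear.Build F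
  (subvs_of A) (subvs_of A) (subvs_of A) *:%R *:%R sub_mul sub_mul_bilinear.

Hypothesis Aalg : subalgebra mu A.

Lemma sub_mulE a b : vsval (sub_mul a b) = mu (vsval a) (vsval b).
Proof. by rewrite vsprojK //; move/prodvsP: Aalg; apply; apply: subvsP. Qed.

Lemma sub_leibniz : leibniz mu -> leibniz sub_mul.
Proof.
by move=> muL x y z; apply: subvs_inj; rewrite linearD /= !sub_mulE muL.
Qed.

End SubAlgebra.

(* Lift a proper supplement of [M / M^2] in [L / M^2] to a proper subalgebra of
   [L] and recurse inside it. *)
Lemma levi (F : fieldType) (L : vectType F) (mu : {bilinear L -> L -> L}) (M : {vspace L}) :
  [pchar F] =i pred0 -> leibniz mu -> ideal mu M -> nilpotent mu M ->
  (forall I, ideal mu I -> (M <= I)%VS -> I = M \/ I = {:L}%VS) ->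
  ({:L} <= prodvs mu {:L} {:L} + M)%VS ->
  exists S, [/\ subalgebra mu S, (M + S = {:L})%VS & (S :&: M = 0)%VS].
Proof.
move=> char0; have [n] := ubnP (\dim {:L}); elim: n L mu M =>
    // n IHn L mu M ltn muL idM nilM maxM perfM.
have [M0|M0] := eqVneq M 0%VS.
  by exists {:L}%VS; rewrite M0 add0v capv0; split=> //; apply: subvf.
pose J := prodvs mu M M.
have idJ : ideal mu J by apply: ideal_square.
have JM : (J <= M)%VS := ideal_subalgebra idM.
have MJ : ~~ (M <= J)%VS.
  apply: contra M0 => MJ; apply/eqP/(square_eq_nilp nilM).
  by apply/eqP; rewrite eqEsubv JM MJ.
pose pi := quot_proj J; pose qmu := quot_mul mu J : {bilinear quotvs J -> quotvs J -> quotvs J}.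
have [|||||||S' [S'alg S'K S'1]] := @proper_supplement F (quotvs J) qmu (pi @: M)%VS.
- exact: char0.
- exact: quot_leibniz.
- exact: quot_ideal_img.
- move=> _ _ /memv_imgP[a aM ->] /memv_imgP[b bM ->]; rewrite /= -quot_projM //.
  by apply/eqP; rewrite -memv_quot memv_prodvs.
- move=> I idI MI; have [||e|e] := maxM (pi @^-1: I)%VS.
  + exact: quot_ideal_preim.
  + by apply/subvP => m mM; rewrite -memv_preim (subvP MI) // memv_img.
  + by left; rewrite -e quot_preimK.
  by right; rewrite -(quot_preimK I) e; apply: quot_img_full.
- by rewrite -!(quot_img_full J) -quot_img_prodvs // -limgD limgS.
- by rewrite quot_img_eq0.
pose A := (pi @^-1: S')%VS.
have Aalg : subalgebra mu A.
  apply/prodvsP => x y; rewrite -!memv_preim quot_projM // => xS yS.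
  by move/prodvsP: S'alg; apply.
have AM : (A + M = {:L})%VS.
  apply/eqP; rewrite eqEsubv subvf -(quot_img_sub (J := J));
      last by apply: subv_trans JM (addvSr _ _).
  by rewrite limgD quot_preimK S'K subvf.
have A1 : A != {:L}%VS.
  by apply: contra S'1 => /eqP e; rewrite -(quot_preimK S') -/A e; apply/eqP/quot_img_full.
have AMP x : exists a m, [/\ a \in A, m \in M & x = a + m].
  have /memv_addP[a aA [m mM ->]] : x \in (A + M)%VS by rewrite AM memvf.
  by exists a, m.
have /idealP idMP := idM.
pose e : 'Hom(subvs_of A, L) := linfun vsval.
have eE a : e a = vsval a by rewrite lfunE.
have eA a : e a \in A by rewrite eE subvsP.
have eM a b : e (sub_mul mu a b) = mu (e a) (e b) by rewrite !eE sub_mulE.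
have e_inj : injective e by move=> a b; rewrite !eE; apply: subvs_inj.
have e_surj x : x \in A -> exists a, x = e a by move=> xA; exists (Subvs xA); rewrite eE.
pose M' := (e @^-1: M)%VS.
have M'P a : (a \in M') = (e a \in M) by rewrite -memv_preim.
have [||||||S [Salg SM S0]] := IHn (subvs_of A) (sub_mul mu (A:=A)) M'.
- have -> : \dim {:subvs_of A} = \dim A by rewrite dimvf.
  apply: leq_trans _ (_ : \dim {:L} <= n)%N; last by [].
  by rewrite ltn_neqAle dimvS ?subvf // andbT; apply: contra A1 => /eqP eq;
      rewrite eqEdim subvf eq /=.
- exact: sub_leibniz.
- apply/idealP => a b; rewrite !M'P !eM => bM; exact: idMP.
- have [k k0] := nilM; exists k; apply/eqP; rewrite -subv0; apply/subvP => a.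
  suff H j b : b \in lcs (sub_mul mu (A:=A)) M' j -> e b \in lcs mu M j.
    by move=> /H; rewrite k0 !memv0 -{1}(linear0 e) (inj_eq e_inj).
  elim: j b => [|j IHj] b; first by rewrite /= M'P.
  case/prodvs_sum => r [rP ->]; rewrite linear_sum big_seq rpred_sum // => p /rP[p1 p2].
  by rewrite /= eM memv_prodvs // -?M'P // IHj.
- move=> I /idealP idI M'I.
  (* Adding [M] turns an ideal of the subalgebra [A] into an ideal of [L], because L = A + M; this
     transports maximality from [M] to [M']. *)
  have idIM : ideal mu (e @: I + M)%VS.
    apply/idealP => x _ /memv_addP[_ /memv_imgP[i iI ->] [m mM ->]].
    have [a [p [/e_surj[a' ->] pM ->]]] := AMP x.
    have [i1 i2] := idI a' i iI.
    have [m1 m2] := idMP (e a' + p) m mM; have [p1 p2] := idMP (e i) p pM.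
    rewrite linearDr [mu (e i + m) _]linearDl /= [mu (e a' + p) (e i)]linearDl [mu (e i)
        _]linearDr /=.
    rewrite -!addrA -!eM; split; apply: memv_add; rewrite ?memv_img ?rpredD //.
  have [|eIM|eIL] := maxM _ idIM; first exact: addvSr.
    left; apply/eqP; rewrite eqEsubv M'I andbT; apply/subvP => i iI.
    by rewrite M'P -eIM (subvP (addvSl _ _)) // memv_img.
  right; apply/eqP; rewrite eqEsubv subvf; apply/subvP => a _.
  have : e a \in (e @: I + M)%VS by rewrite eIL memvf.
  case/memv_addP => _ /memv_imgP[i iI ->] [m mM eq].
  have : a - i \in M' by rewrite M'P linearB /= eq addrC addKr.
  by move=> /(subvP M'I) aiI; rewrite -(subrK i a) rpredD.
- apply/subvP => a _.
  have /memv_addP[y yL2 [m mM eq]] :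
      e a \in (prodvs mu {:L} {:L} + M)%VS by apply: (subvP perfM); rewrite memvf.
  (* Replacing the factors of a product by their components in [A] changes it only by an element of
     [M]. *)
  suff [b bA2 ybM] : exists2 b, b \in prodvs (sub_mul mu (A:=A))
      {:subvs_of A} {:subvs_of A} & y - e b \in M.
    rewrite -(subrK b a) addrC memv_add // M'P linearB /= eq addrAC rpredD //.
  have [r [_ ->]] := prodvs_sum yL2.
  elim: r => [|p r [b bA2 IHr]]; first by exists 0; rewrite ?mem0v // big_nil linear0 subr0 mem0v.
  have [_ [m1 [/e_surj[a1 ->] m1M e1]]] := AMP p.1.
  have [_ [m2 [/e_surj[a2 ->] m2M e2]]] := AMP p.2.
  exists (sub_mul mu a1 a2 + b); first by rewrite rpredD // (memv_prodvs (sub_mul mu (A:=A)))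
      ?memvf.
  rewrite big_cons linearD /= opprD addrACA rpredD // eM.
  rewrite e1 e2 linearDl /= linearDr /= addrAC addrAC -!addrA addrC -!addrA addNr addr0.
  have [? ?] := idMP (e a1) m2 m2M; have [? ?] := idMP (e a2 + m2) m1 m1M.
  by rewrite rpredD.
exists (e @: S)%VS; split.
- apply/prodvsP => _ _ /memv_imgP[a aS ->] /memv_imgP[b bS ->].
  by rewrite -eM memv_img //; move/prodvsP: Salg; apply.
- apply/eqP; rewrite eqEsubv subvf -AM subv_add addvSl andbT.
  apply/subvP => _ /e_surj[a ->].
  have : a \in (M' + S)%VS by rewrite SM memvf.
  case/memv_addP => m; rewrite M'P => mM [s sS ->].
  by rewrite linearD memv_add // memv_img.
apply/eqP; rewrite -subv0; apply/subvP => x; rewrite memv_cap => /andP[/memv_imgP[s sS ->]].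
rewrite -M'P => sM; have /eqP -> : s == 0 by rewrite -memv0 -S0 memv_cap sS.
by rewrite linear0 mem0v.
Qed.

(** * Unique maximal ideals *)

Section UniqueMaximal.
Variables (F : fieldType) (L : vectType F) (mu : {bilinear L -> L -> L}).
Hypothesis muL : leibniz mu.
Implicit Types A I J M N S : {vspace L}.

Lemma perfect_sub_nilp N S : nilpotent mu N -> (S <= N)%VS -> (S <= prodvs mu S S)%VS -> S = 0%VS.
Proof.
move=> [k k0] SN SS; apply/eqP; rewrite -subv0 -k0; elim: k {k0} => // k IHk.
by apply: subv_trans SS _; apply: prodvsS.
Qed.

Lemma nilp_supplement M N : ideal mu M -> nilpotent mu N ->
  (M + N = {:L})%VS -> ({:L} <= M + prodvs mu {:L} {:L})%VS -> M = {:L}%VS.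
Proof.
move=> /idealP idM [k k0] MN ML2.
suff H j : ({:L} <= M + lcs mu N j)%VS.
  by apply/eqP; rewrite eqEsubv subvf; have := H k; rewrite k0 addv0.
elim: j => [|j IHj]; first by rewrite /= MN.
apply: subv_trans ML2 _; rewrite subv_add addvSl; apply/prodvsP => u w _ _.
have /memv_addP[m mM [n nN ->]] : u \in (M + N)%VS by rewrite MN memvf.
have /memv_addP[m' m'M [n' n'N ->]] : w \in (M + lcs mu N j)%VS by rewrite (subvP IHj) ?memvf.
rewrite linearDl /= [mu n _]linearDr /= addrA memv_add ?memv_prodvs // rpredD //.
  by case: (idM (m' + n') m mM).
by case: (idM n m' m'M).
Qed.

Lemma unique_maximal N : ideal mu N -> nilpotent mu N -> N != {:L}%VS ->
  (N <= prodvs mu {:L} {:L})%VS -> (forall J, ideal mu J -> (N <= J)%VS -> J = N \/ J = {:L}%VS) ->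
  exists! M : {vspace L}, maximal_ideal mu M.
Proof.
move=> idN nilN N1 NL2 maxN; exists N; split=> // M [idM M1 maxM].
have [||e|NM] := maxM (M + N)%VS; first exact: idealD.
- exact: addvSl.
- have NM : (N <= M)%VS by rewrite -e addvSr.
  by have [//|eL] := maxN M idM NM; rewrite eL eqxx in M1.
case/eqP: M1; apply: (nilp_supplement idM nilN NM).
by rewrite -{1}NM addvS ?subvv.
Qed.

Lemma codim1_maximal N x J : ({:L} = N + <[x]>)%VS -> (N <= J)%VS -> J = N \/ J = {:L}%VS.
Proof.
move=> LNx NJ; have [JN|JN] := boolP (J <= N)%VS.
  by left; apply/eqP; rewrite eqEsubv JN NJ.
right; apply/eqP; rewrite eqEsubv subvf LNx subv_add NJ -memvE.
have [j jJ jN] := subvPn JN.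
have : j \in (N + <[x]>)%VS by rewrite -LNx memvf.
case/memv_addP => n nN [_ /vlineP[k ->] e].
have k0 : k != 0 by apply: contraNneq jN => k0; rewrite e k0 scale0r addr0.
have -> : x = k^-1 *: (j - n) by rewrite e addrC addKr scalerA mulVf // scale1r.
by rewrite rpredZ // rpredB // (subvP NJ).
Qed.

Lemma nilp_square_neq : nilpotent mu {:L} -> {:L}%VS != 0%VS :> {vspace L} ->
    prodvs mu {:L} {:L} != {:L}%VS.
Proof.
move=> nilL L0; apply: contra L0 => /eqP e; apply/eqP/(perfect_sub_nilp nilL (subvv _)).
by rewrite e.
Qed.

(** Every subspace containing L^2 is an ideal, so for any x outside [M] the ideal M + <x> is already
    [L]. *)
Lemma top_square_line M : top_ideal mu M -> prodvs mu {:L} {:L} != {:L}%VS ->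
  M = prodvs mu {:L} {:L} /\ exists2 x, x \notin M & ({:L} = M + <[x]>)%VS.
Proof.
move=> topM L2; have [idM M1 top] := topM.
have ML2 : M = prodvs mu {:L} {:L}.
  apply/eqP; rewrite eqEsubv (top_ideal_square topM) /=.
  by have [e|//] := top _ (ideal_over_square (subvv (prodvs mu {:L} {:L}))); rewrite e eqxx in L2.
split=> //; have [x _ xM] : exists2 x, x \in {:L}%VS & x \notin M.
  by apply/subvPn; apply: contra M1; rewrite eqEsubv subvf.
exists x => //; have [|-> //|] := top (M + <[x]>)%VS.
  by apply: ideal_over_square; rewrite -ML2 addvSl.
by rewrite subv_add subvv -memvE (negbTE xM).
Qed.

(** For a subalgebra [A] containing x, L = A + [lcs mu {:L} j] persists as j grows: in L^2 the
    products with a factor in that term fall into the next one. *)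
Lemma line_cyclic x : nilpotent mu {:L} -> ({:L} = prodvs mu {:L} {:L} + <[x]>)%VS -> cyclic mu.
Proof.
move=> [k k0] LE; exists x => A Aalg xA.
have AA : forall a b, a \in A -> b \in A -> mu a b \in A by apply/prodvsP.
suff H j : ({:L} <= A + lcs mu {:L} j)%VS.
  by apply/eqP; rewrite eqEsubv subvf; have := H k; rewrite k0 addv0.
elim: j => [|j IHj]; first exact: addvSr.
rewrite {1}LE subv_add -memvE (subvP (addvSl _ _)) // andbT; apply/prodvsP => u w _ _.
have /memv_addP[a aA [l ll ->]] : u \in (A + lcs mu {:L} j)%VS by rewrite (subvP IHj) ?memvf.
have /memv_addP[a' a'A [l' l'l ->]] : w \in (A + lcs mu {:L} j)%VS by rewrite (subvP IHj) ?memvf.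
rewrite linearDl /= !linearDr /= -addrA memv_add ?AA // rpredD //.
  by rewrite memv_prodvs ?memvf.
rewrite rpredD //; last by rewrite memv_prodvs ?memvf.
by rewrite -[j]addn0 (lcs_mul muL) //= memvf.
Qed.

Lemma cyclic_unique_maximal : {:L}%VS != 0%VS :> {vspace L} ->
  nilpotent mu {:L} -> cyclic mu -> exists! M : {vspace L}, maximal_ideal mu M.
Proof.
move=> L0 nilL [x gen]; pose L2 := prodvs mu {:L} {:L}.
have LE : ({:L} = L2 + <[x]>)%VS.
  apply/esym/gen; last by rewrite (subvP (addvSr _ _)) ?memv_line.
  by apply/prodvsP => u w _ _; rewrite (subvP (addvSl _ _)) // memv_prodvs ?memvf.
apply: (@unique_maximal L2).
- exact: ideal_over_square.
- have [k k0] := nilL; exists k; apply/eqP; rewrite -subv0 -k0.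
  by elim: k {k0} => [|k IHk]; [apply: subvf | apply: prodvsS; rewrite ?subvf].
- exact: nilp_square_neq.
- exact: subvv.
by move=> J _; apply: codim1_maximal LE.
Qed.

(** [S] is a copy of L/M: adding [M] to an ideal of [S] gives an ideal of [L], and S^2 = 0 would put
    L^2 = L inside [M]. *)
Lemma simple_complement S M : top_ideal mu M -> prodvs mu {:L} {:L} = {:L}%VS ->
  subalgebra mu S -> (M + S = {:L})%VS -> (S :&: M = 0)%VS -> simple_subalgebra mu S.
Proof.
move=> [idM M1 top] L2 Salg MS SM; have /idealP idMP := idM.
have dec x : exists m s, [/\ m \in M, s \in S & x = m + s].
  have /memv_addP[m mM [s sS ->]] : x \in (M + S)%VS by rewrite MS memvf.
  by exists m, s.
have mulM m s y : m \in M -> mu (m + s) y - mu s y \in M.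
  by move=> mM; rewrite linearDl /= addrK; case: (idMP y m mM).
split=> //.
- apply: contraNneq M1 => SS; rewrite eqEsubv subvf -L2; apply/prodvsP => u w _ _.
  have [m [s [mM sS ->]]] := dec u; have [m' [s' [m'M s'S ->]]] := dec w.
  rewrite -(subrK (mu s (m' + s')) (mu (m + s) _)) rpredD ?mulM // linearDr rpredD //=.
    by case: (idMP s m' m'M).
  have : mu s s' \in prodvs mu S S by apply: memv_prodvs.
  by rewrite SS memv0 => /eqP ->; rewrite mem0v.
move=> I /and3P[IS /prodvsP SI /prodvsP ISI].
have idIM : ideal mu (I + M)%VS.
  apply/idealP => x _ /memv_addP[i iI [m mM ->]]; have [n [s [nM sS ->]]] := dec x.
  have [m1 m2] := idMP (n + s) m mM; have [n1 n2] := idMP i n nM.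
  split.
    rewrite linearDr /= [mu _ i]linearDl /= [mu n i + _]addrC -addrA.
    by rewrite memv_add ?rpredD ?SI.
  rewrite linearDl /= [mu i _]linearDr /= [mu i n + _]addrC -addrA.
  by rewrite memv_add ?rpredD ?ISI.
have zero s : s \in S -> s \in M -> s = 0.
  by move=> sS sM; apply/eqP; rewrite -memv0 -SM memv_cap sS.
have [IL|IM] := top _ idIM; [right | left].
  apply/eqP; rewrite eqEsubv IS; apply/subvP => s sS.
  have /memv_addP[i iI [m mM e]] : s \in (I + M)%VS by rewrite IL memvf.
  have : m = 0 by apply: zero => //; rewrite -(addKr i m) -e addrC rpredB // (subvP IS).
  by move=> m0; rewrite e m0 addr0.
apply/eqP; rewrite -subv0; apply/subvP => i iI; rewrite memv0; apply/eqP/zero.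
  exact: (subvP IS).
by apply: (subvP IM); apply: (subvP (addvSl _ _)).
Qed.

Lemma simple_maximal S N J : simple_subalgebra mu S -> ({:L} = N + S)%VS ->
  ideal mu J -> (N <= J)%VS -> J = N \/ J = {:L}%VS.
Proof.
move=> [/prodvsP Salg _ Smin] LNS /idealP idJ NJ.
have /Smin : ideal_of mu S (S :&: J).
  apply/and3P; split; first exact: capvSl.
    apply/prodvsP => s j sS /memv_capP[jS jJ]; rewrite memv_cap Salg //.
    by case: (idJ s j jJ).
  apply/prodvsP => j s /memv_capP[jS jJ] sS; rewrite memv_cap Salg //.
  by case: (idJ s j jJ).
case=> [SJ0|SJ]; [left | right]; last first.
  by apply/eqP; rewrite eqEsubv subvf LNS subv_add NJ -{1}SJ capvSr.
apply/eqP; rewrite eqEsubv NJ andbT; apply/subvP => j jJ.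
have /memv_addP[n nN [s sS e]] : j \in (N + S)%VS by rewrite -LNS memvf.
have : s \in (S :&: J)%VS.
  by rewrite memv_cap sS -(addKr n s) -e addrC rpredB // (subvP NJ).
by rewrite SJ0 memv0 e => /eqP ->; rewrite addr0.
Qed.

End UniqueMaximal.

Theorem theorem17 (F : fieldType) (char0 : [pchar F] =i pred0)
    (L : vectType F) (Lnz : fullv != 0%VS :> {vspace L})
    (mu : {bilinear L -> L -> L}) (muL : leibniz mu)
    (N : {vspace L}) (nilN : nilradical mu N) :
  let N2 := prodvs mu N N in
  let pi := quot_proj N2 in
  let qmu : {bilinear quotvs N2 -> quotvs N2 -> quotvs N2} := quot_mul mu N2 in
  (exists! M : {vspace L}, maximal_ideal mu M)
  <->
  [\/ nilpotent mu {:L} /\ cyclic mu,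
      exists S : {vspace L},
        [/\ simple_subalgebra mu S, {:L}%VS = (N + S)%VS &
            (pi @: N)%VS =
              (prodvs qmu (pi @: S) (pi @: N) + prodvs qmu (pi @: N) (pi @: S))%VS],
      exists x : L,
        [/\ \dim <[x]> = 1%N, {:L}%VS = (N + <[x]>)%VS, mu x x != 0 &
            (pi @: N)%VS = prodvs qmu <[pi x]> (pi @: {:L})]
    | exists x : L,
        [/\ \dim <[x]> = 1%N, {:L}%VS = (N + <[x]>)%VS, mu x x = 0 &
            (pi @: N)%VS =
              (prodvs qmu <[pi x]> (pi @: N) + prodvs qmu (pi @: N) <[pi x]>)%VS]].
Proof.
move=> N2 pi qmu; have [idN nlN maxN] := nilN.
have idN2 : ideal mu N2 by apply: ideal_square.
have /idealP idNP := idN; have /idealP idN2P := idN2.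
set L2 := prodvs mu {:L} {:L}.
have N2N : (N2 <= N)%VS := ideal_subalgebra idN.
have N2L2 : (N2 <= L2)%VS by apply: prodvsS; apply: subvf.
have img U W : (pi @: prodvs mu U W)%VS = prodvs qmu (pi @: U) (pi @: W).
  exact: quot_img_prodvs.
(* Equalities in N/N^2 are thus checked in [L], up to a summand [N2]. *)
have imgU U : (U <= N)%VS -> (N <= U + N2)%VS -> (pi @: N)%VS = (pi @: U)%VS.
  move=> UN NU; apply/eqP; rewrite eqEsubv [X in _ && X]limgS // andbT.
  apply: subv_trans (limgS pi NU) _; rewrite limgD subv_add subvv /=.
  by rewrite (_ : (pi @: N2 = 0)%VS) ?sub0v //; apply/eqP; rewrite quot_img_eq0.
have N_neq : (N <= L2)%VS -> N != {:L}%VS.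
  move=> NL2; apply: contraNneq Lnz => e; apply/eqP/(@perfect_sub_nilp _ _ mu N) => //.
    by rewrite e.
  by rewrite -{1}e.
have sub_L2 : (pi @: N <= pi @: L2)%VS -> (N <= L2)%VS by rewrite quot_img_sub.
have imgL2 : (prodvs qmu (pi @: {:L}) (pi @: {:L}) <= pi @: L2)%VS by rewrite img.
split=> [[M [maxM uniqM]] | [[nilL cyc]|[S [Ssimp LNS NE]]|[x [_ LNx _ NE]]|[x [_ LNx _ NE]]]].
- have topM : top_ideal mu M by apply: top_idealP => // M' /uniqM.
  have nilM := top_ideal_nilpotent char0 muL topM.
  have [idM M1 top] := topM.
  have MN := maxN M idM nilM.
  have [NL|NM] := top N idN.
    have nilL : nilpotent mu {:L} by rewrite -NL.
    have [ML2 [x _ LMx]] := top_square_line topM (nilp_square_neq nilL Lnz).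
    by apply: Or41; split=> //; apply: (@line_cyclic _ _ _ muL x) => //; rewrite -ML2.
  have {NM MN} eMN : M = N by apply/eqP; rewrite eqEsubv MN NM.
  subst M.
  have [L2L|L2L] := eqVneq L2 {:L}%VS.
    have [||S [Salg NS SN]] := levi char0 muL idN nlN.
    - by move=> I idI NI; have [->|IN] := top I idI; [right | left; apply/eqP; rewrite eqEsubv IN].
    - by rewrite -/L2 L2L addvSl.
    have Ssimp := simple_complement topM L2L Salg NS SN.
    apply: Or42; exists S; split=> //; rewrite -!img -limgD; apply: imgU.
      rewrite subv_add; apply/andP; split; apply/prodvsP => u w.
        by move=> _ wN; case: (idNP u w wN).
      by move=> uN _; case: (idNP w u uN).
    set W := (_ + _)%VS; apply/subvP => n nN.
    (* Expanding L^2 = L along L = N + S shows L = S + W with [W] inside [N]; as [S] meets [N] in 0,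
       [N] lies in [W]. *)
    have L2SW : (L2 <= S + W)%VS.
      apply/prodvsP => u w _ _.
      have /memv_addP[m mN [s sS ->]] : u \in (N + S)%VS by rewrite NS memvf.
      have /memv_addP[m' m'N [s' s'S ->]] : w \in (N + S)%VS by rewrite NS memvf.
      have inW z : z \in W -> z \in (S + W)%VS by apply: (subvP (addvSr _ _)).
      have inW1 z : z \in prodvs mu S N -> z \in W.
        by move=> zSN; apply: (subvP (addvSl _ _)); apply: (subvP (addvSl _ _)).
      have inW2 z : z \in prodvs mu N S -> z \in W.
        by move=> zNS; apply: (subvP (addvSl _ _)); apply: (subvP (addvSr _ _)).
      have inW3 z : z \in N2 -> z \in W by apply: (subvP (addvSr _ _)).
      rewrite linearDl /= !linearDr /=; apply: rpredD; apply: rpredD.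
      - by apply/inW/inW3/memv_prodvs.
      - by apply/inW/inW2/memv_prodvs.
      - by apply/inW/inW1/memv_prodvs.
      by apply: (subvP (addvSl _ _)); move/prodvsP: Salg; apply.
    have : n \in (S + W)%VS by apply: (subvP L2SW); rewrite L2L memvf.
    case/memv_addP => s sS [w wW e].
    have WN : (W <= N)%VS.
      rewrite !subv_add N2N andbT; apply/andP; split; apply/prodvsP => u z.
        by move=> _ zN; case: (idNP u z zN).
      by move=> uN _; case: (idNP z u uN).
    have : s \in (S :&: N)%VS.
      by rewrite memv_cap sS -(addrK w s) -e rpredB // (subvP WN).
    by rewrite SN memv0 e => /eqP ->; rewrite add0r.
  have [NL2 [x xN LNx]] := top_square_line topM L2L.
  have x0 : x != 0 by apply: contraNneq xN => ->; apply: mem0v.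
  have dimx : \dim <[x]> = 1%N by rewrite dim_vline x0.
  have dec y : exists n k, n \in N /\ y = n + k *: x.
    have : y \in (N + <[x]>)%VS by rewrite -LNx memvf.
    by case/memv_addP => n nN [_ /vlineP[k ->] ->]; exists n, k.
  have L2N u w : mu u w \in N by rewrite NL2 memv_prodvs ?memvf.
  have [xx0|xx0] := eqVneq (mu x x) 0; [apply: Or44 | apply: Or43]; exists x; split=> //.
    rewrite -!limg_line -!img -limgD; apply: imgU.
      by rewrite subv_add; apply/andP; split; apply/prodvsP => u w _ _.
    rewrite {1}NL2; apply/prodvsP => u w _ _.
    have [n [k [nN ->]]] := dec u; have [n' [k' [n'N ->]]] := dec w.
    have inW1 : mu x n' \in (prodvs mu <[x]> N + prodvs mu N <[x]> + N2)%VS.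
      by apply: (subvP (addvSl _ _)); apply: (subvP (addvSl _ _)); rewrite memv_prodvs ?memv_line.
    have inW2 : mu n x \in (prodvs mu <[x]> N + prodvs mu N <[x]> + N2)%VS.
      by apply: (subvP (addvSl _ _)); apply: (subvP (addvSr _ _)); rewrite memv_prodvs ?memv_line.
    rewrite linearDl /= !linearDr /= !linearZr_LR /= !linearZl_LR /= xx0 !scaler0 addr0.
    apply: rpredD; last by rewrite rpredZ.
    by apply: rpredD; [apply: (subvP (addvSr _ _)); apply: memv_prodvs | rewrite rpredZ].
  rewrite -!limg_line -!img; apply: imgU.
    by apply/prodvsP => u w _ _.
  set W := (_ + _)%VS.
  have xW y : mu x y \in W by rewrite (subvP (addvSl _ _)) // memv_prodvs ?memv_line ?memvf.
  have N2W y : y \in N2 -> y \in W by apply: (subvP (addvSr _ _)).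
  (* x^2 lies in L^2 = N, so left multiplication by [N] sends it into N^2, and left multiplication
     by x into xL. *)
  have xxW y : mu y (mu x x) \in W.
    have [n [k [nN ->]]] := dec y; rewrite linearDl /= linearZl_LR rpredD ?rpredZ //.
    by rewrite N2W // memv_prodvs.
  (* Write n in N = L^2 as a sum of products. The identity (yz)x = y(zx) - z(yx) reduces each
     contribution to nx to elements of xL, of [N2], or of the form y(xx). *)
  have nxW n : n \in N -> mu n x \in W.
    rewrite {1}NL2 => /prodvs_sum[r [_ ->]]; rewrite linear_sumlz rpred_sum // => p _.
    have [m [k [mN ->]]] := dec p.1; rewrite linearDl /= linearZl_LR linearDl /= linearZl_LR /=.
    apply: rpredD; last by rewrite rpredZ // leibniz_l // rpredB.
    have [n' [k' [n'N ->]]] := dec p.2.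
    rewrite linearDr /= linearZr_LR linearDl /= linearZl_LR /= rpredD //.
      by apply: N2W; case: (idN2P x _ (memv_prodvs mu mN n'N)).
    by rewrite rpredZ // leibniz_l // rpredB.
  rewrite {1}NL2; apply/prodvsP => u w _ _.
  have [n [k [nN ->]]] := dec u; have [n' [k' [n'N ->]]] := dec w.
  rewrite linearDl /= linearDr /= linearZr_LR /= linearZl_LR /=.
  rewrite !rpredD ?rpredZ ?xW ?nxW // N2W // memv_prodvs //.
- exact: cyclic_unique_maximal.
- have NL2 : (N <= L2)%VS.
    apply: sub_L2; rewrite NE subv_add; apply/andP; split; apply: subv_trans imgL2;
        apply: prodvsS; apply: limgS; apply: subvf.
  apply: (@unique_maximal _ _ _ N) => //; first exact: N_neq.
  by move=> J; apply: simple_maximal LNS.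
- have NL2 : (N <= L2)%VS.
    apply: sub_L2; rewrite NE -limg_line; apply: subv_trans imgL2; apply: prodvsS; apply: limgS;
        apply: subvf.
  apply: (@unique_maximal _ _ _ N) => //; first exact: N_neq.
  by move=> J _; apply: codim1_maximal LNx.
have NL2 : (N <= L2)%VS.
  apply: sub_L2; rewrite NE -limg_line subv_add; apply/andP; split; apply: subv_trans imgL2;
      apply: prodvsS; apply: limgS; apply: subvf.
apply: (@unique_maximal _ _ _ N) => //; first exact: N_neq.
by move=> J _; apply: codim1_maximal LNx.
Qed.
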